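(* Let $\Omega_4=\{mn : mn>64,\ 8\le m\le 64,\ m\equiv 2\pmod 4,\ n\ge5,\ n\equiv 1\pmod 2\}$. For every $N\in\Omega_4$ there exists an MS$(N,2)$.
   Context: An $n\times n$ integer matrix is a general magic square if all row sums, column sums and the two diagonal sums $\sum_i a_{i,i}$, $\sum_i a_{i,n-1-i}$ are equal. An MS$(n,2)$ (bimagic square of order $n$) is an $n\times n$ matrix whose entries are exactly $0,1,\dots,n^2-1$ such that both the matrix and its entrywise square $(a_{i,j}^2)$ are general magic squares. (It is known that an MS$(n,2)$ exists for every $8\le n\le 64$.) *)

(* Defs.v *)
From mathcomp Require Import all_boot all_order all_algebra.
Set Implicit Arguments. Unset Strict Implicit. Unset Printing Implicit Defensive.
Import GRing.Theory Num.Theory.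
Local Open Scope ring_scope.

Definition general_magic (n : nat) (A : 'M[int]_n) : Prop :=
  exists s : int,
    (forall i : 'I_n, \sum_(j < n) A i j = s) /\
    (forall j : 'I_n, \sum_(i < n) A i j = s) /\
    \sum_(i < n) A i i = s /\
    \sum_(i < n) A i (rev_ord i) = s.

Definition entries_0_to_sq (n : nat) (A : 'M[int]_n) : Prop :=
  perm_eq [seq A ij.1 ij.2 | ij : 'I_n * 'I_n]
          [seq (k%:Z) | k <- iota 0 (n ^ 2)].

Definition bimagic (n : nat) (A : 'M[int]_n) : Prop :=
  entries_0_to_sq A /\ general_magic A /\ general_magic (map_mx (fun x => x ^+ 2) A).

Definition Omega4 (N : nat) : Prop :=
  exists m n : nat,
    (N = m * n /\ 64 < m * n /\ 8 <= m <= 64 /\ m %% 4 = 2 /\ 5 <= n /\ odd n)%N.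

(* Main.v *)
(* With m = 2 mod 4 the order is a product of m or 3m, a power of 9 and a factor prime to 6.  If A is
   bimagic of order m and every cell (i, j) of A carries an n x n square B_ij filled with
   0 .. n^2-1, then n^2 A + B is bimagic of order mn as soon as the B_ij have constant row and column
   sums (so that the cross terms A B are constant) and their sums of squares balance along the lines
   of the big square; the B_ij need not be bimagic.  For odd n, orthogonal Latin squares L1, L2 give
   B = n L1 + L2 and B' = n L1 + (n-1-L2), whose sums of squares along a common Latin line add up to
   a constant.  It remains to distribute B and B' over the cells evenly in each row, column and
   diagonal.
   For n prime to 6 the Latin squares k + 2l and k - 2l mod n are Latin on both diagonals.  For n = 3
   there is no such pair; instead the rows of B_ij are permuted according to i and its columns
   according to j, in such a way that the diagonals balance, which depends on the entries of A.  The
   factor 9 is an ordinary product with a bimagic square of order 9.  The squares A, and the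
   permutations for n = 3, were found by a computer search: fill rows, then columns, by
   meet-in-the-middle, then permute rows and columns to get the diagonals. *)
From Stdlib Require Import NArith.
Require Import Defs.
From mathcomp Require Import all_boot all_order all_algebra.
From mathcomp Require Import ring zify.
Set Implicit Arguments. Unset Strict Implicit. Unset Printing Implicit Defensive.

(** * Bimagic squares and block substitution *)

(** A plain product would need a bimagic square for every factor, small ones such as 3, 5 and 7
    included; the pair B, B' replaces it by a property of two Latin squares. The condition prime to
    6 comes from the diagonals: the square k + c l is Latin in rows, columns and both diagonals
    exactly when c, c + 1 and c - 1 are units mod n, and three consecutive residues cannot all be
    units when 2 or 3 divides n. Slopes 2 and -2 are the simplest choice, and their difference 4 is
    then a unit too, which makes the two squares orthogonal. For n = 3 the row permutation depends
    on i alone and the column permutation on j alone. A row of the big square therefore meets the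
    same inner row in all its blocks, up to the order of the cells, so rows and columns balance for
    every choice of permutations and only the two diagonals restrict it. The price is that tripling
    is tied to the numbers of one table and cannot be iterated. This fixes the order of the steps:
    at most one factor 3 on a listed square, then factors 9, and last the factor prime to 6, a step
    that accepts any square whose order exceeds 2 and is 2 mod 4. *)

Definition line (n S Q : nat) (f : nat -> nat) : Prop :=
  \sum_(k < n) f k = S /\ \sum_(k < n) f k ^ 2 = Q.

(** By counting, injectivity on the $n^2$ cells and the bound force every value below [n ^ 2] to
    occur. Indices are plain naturals so that the cells of a big square can be addressed by quotient
    and remainder. *)
Definition filling (n : nat) (X : nat -> nat -> nat) : Prop :=
  (forall i j, i < n -> j < n -> X i j < n ^ 2) /\
  (forall i j i' j', i < n -> j < n -> i' < n -> j' < n ->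
     X i j = X i' j' -> i = i' /\ j = j').

Definition square (n S Q : nat) (X : nat -> nat -> nat) : Prop :=
  [/\ filling n X,
      forall i, i < n -> line n S Q (X i),
      forall j, j < n -> line n S Q (X^~ j),
      line n S Q (fun i => X i i)
    & line n S Q (fun i => X i (n.-1 - i))].

Definition has_square (n : nat) : Prop := exists S Q X, square n S Q X.

Lemma has_square_bimagic n : has_square n -> exists A : 'M[int]_n, bimagic A.
Proof.
case=> S [Q [X [[Xlt Xinj] Xrow Xcol Xd Xa]]].
have sumE T f (F : 'I_n -> int) : (forall i : 'I_n, F i = Posz (f i)) ->
    \sum_(i < n) f i = T -> (\sum_(i < n) F i)%R = Posz T.
  move=> FE <-; rewrite (eq_bigr (fun i : 'I_n => Posz (f i))) //.
  by rewrite -(big_morph Posz PoszD (erefl _)).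
have revE (i : 'I_n) : rev_ord i = n.-1 - i :> nat by rewrite /=; lia.
exists (\matrix_(i, j) Posz (X i j))%R; split; [|split].
- have uA : uniq [seq ((\matrix_(i, j) Posz (X i j)) ij.1 ij.2)%R | ij : 'I_n * 'I_n].
    rewrite map_inj_uniq ?enum_uniq // => -[i j] [i' j'] /=.
    rewrite !mxE => -[] /Xinj [] // ei ej.
    by congr pair; apply: val_inj.
  have uI : uniq [seq Posz k | k <- iota 0 (n ^ 2)]%R.
    by rewrite map_inj_uniq ?iota_uniq // => a b [].
  (* A duplicate-free list contained in a list that is no longer has the same members, so
     surjectivity needs no argument of its own. *)
  apply: uniq_perm => //; apply: (uniq_min_size uA _ _).2 => [x|].
    by case/mapP=> -[i j] _ -> /=; rewrite mxE map_f // mem_iota; apply: Xlt.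
  by rewrite size_map size_iota size_image card_prod card_ord mulnn.
- exists (Posz S); split; [|split; [|split]] => [i|j||].
  + by apply: (sumE _ (X i)) => [j|]; rewrite ?mxE; last case: (Xrow i).
  + by apply: (sumE _ (X^~ j)) => [i|]; rewrite ?mxE; last case: (Xcol j).
  + by apply: (sumE _ (fun i => X i i)) => [i|]; rewrite ?mxE; last case: Xd.
  + by apply: (sumE _ (fun i => X i (n.-1 - i))) => [i|]; rewrite ?mxE ?revE; last case: Xa.
- exists (Posz Q); split; [|split; [|split]] => [i|j||].
  + by apply: (sumE _ (fun j => X i j ^ 2)) => [j|]; rewrite ?mxE; last case: (Xrow i).
  + by apply: (sumE _ (fun i => X i j ^ 2)) => [i|]; rewrite ?mxE; last case: (Xcol j).
  + by apply: (sumE _ (fun i => X i i ^ 2)) => [i|]; rewrite ?mxE; last case: Xd.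
  + by apply: (sumE _ (fun i => X i (n.-1 - i) ^ 2)) => [i|]; rewrite ?mxE ?revE; last case: Xa.
Qed.

Lemma sum_divmod m n (F : nat -> nat -> nat) :
  \sum_(r < m * n) F (r %/ n) (r %% n) = \sum_(i < m) \sum_(k < n) F i k.
Proof.
rewrite -(big_mkord xpredT (fun r => F (r %/ n) (r %% n))) big_nat_mul big_mkord.
apply: eq_bigr => i _; rewrite -{1}[i * n]add0n mulSn big_addn addnK big_mkord.
apply: eq_bigr => k _; have n0 := leq_ltn_trans (leq0n k) (ltn_ord k).
by rewrite addnC divnMDl ?modnMDl ?divn_small ?modn_small ?addn0.
Qed.

(* The conditions on the blocks met by a line with entries f, the i-th block contributing the values
   g i k, under which n^2 f + g is again a line with prescribed sums; r is the line sum of a block. *)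
Definition mix (m n S r R : nat) (f : nat -> nat) (g : nat -> nat -> nat) : Prop :=
  [/\ \sum_(i < m) \sum_(k < n) g i k = m * r,
      \sum_(i < m) f i * \sum_(k < n) g i k = r * S
    & \sum_(i < m) \sum_(k < n) g i k ^ 2 = R].

(** Equal line sums in all blocks let [r] factor out of the cross term, which leaves only the
    balance of the squares to be proved. *)
Lemma mix_const m n S Q r R (f : nat -> nat) (g : nat -> nat -> nat) : line m S Q f ->
  (forall i, i < m -> \sum_(k < n) g i k = r) ->
  \sum_(i < m) \sum_(k < n) g i k ^ 2 = R -> mix m n S r R f g.
Proof.
move=> [fS _] gr gR; split=> //.
  rewrite (eq_bigr (fun=> r)) => [|i _]; last exact: gr.
  by rewrite sum_nat_const card_ord.
rewrite (eq_bigr (fun i : 'I_m => f i * r)) => [|i _]; last by rewrite gr.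
by rewrite -big_distrl /= fS mulnC.
Qed.

(** Each entry of [f] is met by [n] cells, so its weight $n^2$ becomes $n^3$ in the sum and its
    weight $n^4$ becomes $n^5$ in the sum of squares. The cross term of the expanded square is
    $2n^2$ times the weighted sum in [mix]. *)
Lemma line_mix m n S Q r R (f : nat -> nat) (g : nat -> nat -> nat) : line m S Q f -> mix m n S r R f g ->
  line (m * n) (n ^ 3 * S + m * r) (n ^ 5 * Q + 2 * n ^ 2 * r * S + R)
    (fun x => n ^ 2 * f (x %/ n) + g (x %/ n) (x %% n)).
Proof.
move=> [fS fQ] [g1 fg g2]; split.
  rewrite (sum_divmod m n (fun i k => n ^ 2 * f i + g i k)).
  under eq_bigr => i _ do rewrite big_split sum_nat_const card_ord /=.
  by rewrite big_split /= g1 -!big_distrr /= fS; ring.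
rewrite (sum_divmod m n (fun i k => (n ^ 2 * f i + g i k) ^ 2)).
have E (i : 'I_m) : \sum_(k < n) (n ^ 2 * f i + g i k) ^ 2 =
    n ^ 5 * f i ^ 2 + (2 * n ^ 2 * (f i * \sum_(k < n) g i k) + \sum_(k < n) g i k ^ 2).
  under eq_bigr => k _ do rewrite sqrnD -addnA addnC mulnA -addnA.
  rewrite 2!big_split /= sum_nat_const card_ord -big_distrr /= expnMn.
  by ring.
rewrite (eq_bigr _ (fun i _ => E i)) 2!big_split /= g2 -!big_distrr /= fQ fg.
by ring.
Qed.

(** An entry of the big square has the base-$n^2$ digits [A] and [B]. The high digit determines the
    block and the low digit the cell inside it, whence injectivity. Sharing [r] and [R] among all
    lines makes the final sums agree. *)
Lemma square_blocks m n S Q r R (A : nat -> nat -> nat) (B : nat -> nat -> nat -> nat -> nat) :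
  0 < n ->
  square m S Q A ->
  (forall i j, i < m -> j < m -> filling n (B i j)) ->
  (forall i k, i < m -> k < n -> mix m n S r R (A i) (fun j => B i j k)) ->
  (forall j l, j < m -> l < n -> mix m n S r R (A^~ j) (fun i k => B i j k l)) ->
  mix m n S r R (fun i => A i i) (fun i k => B i i k k) ->
  mix m n S r R (fun i => A i (m.-1 - i)) (fun i k => B i (m.-1 - i) k (n.-1 - k)) ->
  has_square (m * n).
Proof.
move=> n0 [[Alt Ainj] Ar Ac Ad Aa] BF Br Bc Bd Ba.
have dlt x : x < m * n -> x %/ n < m by move=> h; rewrite ltn_divLR.
have mlt x : x %% n < n by rewrite ltn_mod.
exists (n ^ 3 * S + m * r), (n ^ 5 * Q + 2 * n ^ 2 * r * S + R).
exists (fun x y => n ^ 2 * A (x %/ n) (y %/ n) + B (x %/ n) (y %/ n) (x %% n) (y %% n)).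
split=> [|x xl|y yl||].
- split=> [x y xl yl|x y x' y' xl yl xl' yl'].
    have := Alt _ _ (dlt _ xl) (dlt _ yl).
    have := (BF _ _ (dlt _ xl) (dlt _ yl)).1 _ _ (mlt x) (mlt y).
    rewrite expnMn; nia.
  set a := A _ _; set b := B _ _ _ _; set a' := A _ _; set b' := B _ _ _ _ => e.
  have bl : b < n ^ 2 by apply: (BF _ _ (dlt _ xl) (dlt _ yl)).1.
  have bl' : b' < n ^ 2 by apply: (BF _ _ (dlt _ xl') (dlt _ yl')).1.
  have ea : a = a' by nia.
  have eb : b = b' by nia.
  have [ex ey] := Ainj _ _ _ _ (dlt _ xl) (dlt _ yl) (dlt _ xl') (dlt _ yl') ea.
  move: eb; rewrite /b /b' -ex -ey => eb.
  have [fx fy] := (BF _ _ (dlt _ xl) (dlt _ yl)).2 _ _ _ _ (mlt _) (mlt _) (mlt _) (mlt _) eb.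
  by rewrite (divn_eq x n) (divn_eq y n) (divn_eq x' n) (divn_eq y' n) ex ey fx fy.
- exact: (line_mix (Ar _ (dlt _ xl)) (Br _ _ (dlt _ xl) (mlt _))).
- exact: (line_mix (Ac _ (dlt _ yl)) (Bc _ _ (dlt _ yl) (mlt _))).
- exact: line_mix Ad Bd.
(* Reversing an index reverses both its quotient and its remainder by [n], so the big antidiagonal
   runs through the antidiagonals of the antidiagonal blocks. *)
have revE x : x < m * n -> ((m * n).-1 - x) %/ n = m.-1 - x %/ n /\
    ((m * n).-1 - x) %% n = n.-1 - x %% n.
  move=> xl; have dl := dlt _ xl; have ml := mlt x.
  have -> : (m * n).-1 - x = (m.-1 - x %/ n) * n + (n.-1 - x %% n).
    rewrite {1}(divn_eq x n); move: dl ml; set q := x %/ n; set k := x %% n => dl ml.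
    (* The names [d] and [c] for the reversed digits eliminate truncated subtraction. *)
    have [d em] : exists d, m = q + d.+1 by exists (m - q.+1); lia.
    have [c ec] : exists c, n = k + c.+1 by exists (n - k.+1); lia.
    have -> : m.-1 - q = d by lia.
    have -> : n.-1 - k = c by lia.
    rewrite em mulnDl mulSn; lia.
  have lt : n.-1 - x %% n < n by lia.
  by rewrite divnMDl // modnMDl (divn_small lt) (modn_small lt) addn0.
have [s1 s2] := line_mix Aa Ba; split.
  rewrite -s1; apply: eq_bigr => x _; by case: (revE x (ltn_ord x)) => -> ->.
by rewrite -s2; apply: eq_bigr => x _; case: (revE x (ltn_ord x)) => -> ->.
Qed.

(** With one bimagic square in every block all blocks contribute alike, so each of the [m] blocks on
    a line adds the same sum of squares. *)
Lemma has_square_mul m n : 0 < n -> has_square m -> has_square n -> has_square (m * n).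
Proof.
move=> n0 [S [Q [A hA]]] [r [R [B hB]]].
have [_ Ar Ac Ad Aa] := hA; have [BF Br Bc Bd Ba] := hB.
have cst (f g : nat -> nat) : line m S Q f -> line n r R g -> mix m n S r (m * R) f (fun=> g).
  move=> hf [g1 g2]; apply: (mix_const hf) => // .
  by rewrite g2 sum_nat_const card_ord.
apply: (square_blocks (r := r) (R := m * R) (B := fun _ _ => B) n0 hA) => [//|i k il kl|j l jl ll||].
- exact: cst (Ar _ il) (Br _ kl).
- exact: cst (Ac _ jl) (Bc _ ll).
- exact: cst Ad Bd.
- exact: cst Aa Ba.
Qed.

(** * Blocks from orthogonal Latin squares *)

Lemma eqn_mod_affine n p q x y : coprime p n ->
  (p * x + q == p * y + q %[mod n]) = (x == y %[mod n]).
Proof.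
move=> pn; rewrite eqn_modDr.
wlog yx : x y / y <= x.
  by move=> H; case/orP: (leq_total x y) => /H // h; rewrite eq_sym h eq_sym.
by rewrite !eqn_mod_dvd ?leq_mul // -mulnBr Gauss_dvdr // coprime_sym.
Qed.

Lemma affine_inj n p q x y : coprime p n -> x < n -> y < n ->
  p * x + q = p * y + q %[mod n] -> x = y.
Proof.
by move=> pn xn yn /eqP; rewrite eqn_mod_affine // !modn_small // => /eqP.
Qed.

(** For [p] prime to [n] the map $k \mapsto pk + q$ permutes the residues mod [n], and [F] depends
    on the residue only. *)
Lemma sum_affine n p q (F : nat -> nat) : coprime p n ->
  (forall v, F (v %% n) = F v) -> \sum_(k < n) F (p * k + q) = \sum_(k < n) F k.
Proof.
move=> pn Fn; case: n pn Fn => [|n] pn Fn; first by rewrite !big_ord0.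
pose h (k : 'I_n.+1) := Ordinal (ltn_pmod (p * k + q) (ltn0Sn n)).
rewrite [RHS](reindex_inj (h := h)) => [|k l [] /affine_inj e]; last first.
  by apply: val_inj; exact: e pn _ _.
by apply: eq_bigr => k _; rewrite /= Fn.
Qed.

Arguments sum_affine {n p} q {F}.

(** The low digit of a block entry: the second Latin square or its complement, chosen by a sign
    [b]. *)
Definition shade (n : nat) (b : bool) (v : nat) := if b then v %% n else n.-1 - v %% n.

Arguments shade : simpl never.

(** Closed forms would bring in divisions by 2 and 6; it only matters that these sums are the same
    for every line. *)
Definition sum1 n := \sum_(k < n) k.
Definition sum2 n := \sum_(k < n) k ^ 2.

Lemma sum_mod (G : nat -> nat) n : \sum_(k < n) G (k %% n) = \sum_(k < n) G k.
Proof. by apply: eq_bigr => k _; rewrite modn_small. Qed.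

Lemma sum_shade (G : nat -> nat) n b : \sum_(k < n) G (shade n b k) = \sum_(k < n) G k.
Proof.
case: b; first exact: sum_mod.
rewrite [RHS](reindex_inj rev_ord_inj) /=; apply: eq_bigr => k _.
by rewrite /shade modn_small //; congr G; lia.
Qed.

Section LatinLine.
Variables (n a b a' b' : nat).
Hypotheses (an : coprime a n) (an' : coprime a' n).
Let x k := (a * k + b) %% n.
Let y t k := shade n t (a' * k + b').

Lemma shade_mod t v : shade n t (v %% n) = shade n t v.
Proof. by rewrite /shade modn_mod. Qed.

Lemma sum_x (G : nat -> nat) : \sum_(k < n) G (x k) = \sum_(k < n) G k.
Proof.
rewrite (sum_affine b (F := fun v => G (v %% n))) ?sum_mod // => v.
by rewrite modn_mod.
Qed.

Lemma sum_y t (G : nat -> nat) : \sum_(k < n) G (y t k) = \sum_(k < n) G k.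
Proof.
rewrite (sum_affine b' (F := fun v => G (shade n t v))) ?sum_shade // => v.
by rewrite shade_mod.
Qed.

Lemma latin_line_sum t : \sum_(k < n) (n * x k + y t k) = n.+1 * sum1 n.
Proof.
by rewrite big_split /= -big_distrr (sum_x id) (sum_y t id) /sum1 mulSn addnC.
Qed.

(** In $(nX+Y)^2 + (nX+n-1-Y)^2$ the products $XY$ cancel, so the total depends only on which values
    $X$ and $Y$ take along the line, not on how they are paired. Both take every value below [n]
    once. *)
Lemma latin_line_sq :
  \sum_(k < n) (n * x k + y true k) ^ 2 + \sum_(k < n) (n * x k + y false k) ^ 2 =
  2 * n ^ 2 * sum2 n + 2 * n * n.-1 * sum1 n + 2 * sum2 n.
Proof.
rewrite -big_split /=.
have E (k : 'I_n) : (n * x k + y true k) ^ 2 + (n * x k + y false k) ^ 2 =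
    2 * n ^ 2 * x k ^ 2 + 2 * n * n.-1 * x k + (y true k ^ 2 + y false k ^ 2).
  have : (a' * k + b') %% n <= n.-1.
    by rewrite -ltnS prednK ?ltn_mod // (leq_ltn_trans (leq0n k)).
  (* [Z] stands for the complement of [Y]; substituting [Y + Z] for [n.-1] turns the identity into
     one without subtraction. *)
  rewrite /y /shade; move: (x k) (_ %% n) => X Y /subnK.
  by rewrite addnC; move: (_ - _) => Z <-; ring.
rewrite (eq_bigr _ (fun k _ => E k)) !big_split /= -!big_distrr /=.
rewrite (sum_x id) (sum_x (fun z => z ^ 2)) !(sum_y _ (fun z => z ^ 2)).
by rewrite -/(sum1 n) -/(sum2 n); ring.
Qed.

End LatinLine.

(** Both values of [G] are taken [h] times, so only their sum has to be known, and that is what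
    [latin_line_sq] provides. *)
Lemma sum_balanced m h (s : nat -> bool) (G : bool -> nat) :
  m = h.*2 -> \sum_(j < m) s j = h -> \sum_(j < m) G (s j) = h * (G true + G false).
Proof.
move=> mh sh.
have E : \sum_(j < m) ~~ s j = h.
  apply: (@addnI h); rewrite -{1}sh -big_split /= (eq_bigr (fun=> 1)) => [|j _].
    by rewrite sum_nat_const card_ord muln1 mh addnn.
  by case: (s j).
rewrite (eq_bigr (fun j : 'I_m => s j * G true + ~~ s j * G false)) => [|j _].
  by rewrite big_split /= -!big_distrl /= sh E mulnDr.
by case: (s j); rewrite ?mul1n ?mul0n ?addn0.
Qed.

Section Latin.
Variables (m h n c e : nat) (p q p' q' : nat -> nat) (s : nat -> nat -> bool).
Variables (S Q : nat) (A : nat -> nat -> nat).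

(** With $u = p_i k + q_i$ and $v = p'_j l + q'_j$ the digits in base [n] are $u + cv$ and $u +
    (c+e)v$, the second one possibly complemented. Units [c] and [c + e] make both squares Latin;
    [e] is the determinant, so its being a unit makes them orthogonal. All blocks met by a row of
    the big square share $u$, and all blocks met by a column share $v$. *)
Definition latin_block i j k l :=
  n * ((p i * k + q i + c * (p' j * l + q' j)) %% n) +
  shade n (s i j) (p i * k + q i + (c + e) * (p' j * l + q' j)).

(** A line meets [h] pairs of blocks with opposite signs, each pair contributing the constant of
    [latin_line_sq]. *)
Definition latin_sq := h * (2 * n ^ 2 * sum2 n + 2 * n * n.-1 * sum1 n + 2 * sum2 n).

Hypotheses (n0 : 0 < n) (mh : m = h.*2).
Hypotheses (cn : coprime c n) (en : coprime e n) (cen : coprime (c + e) n).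
Hypotheses (pn : forall i, i < m -> coprime (p i) n) (pn' : forall j, j < m -> coprime (p' j) n).

(** An entry determines both its digits mod [n]. Their difference is $ev$, which gives $v$ since [e]
    is a unit; then $u$ follows, and the affine maps to $u$ and $v$ are injective. Complementing the
    low digit loses nothing. *)
Lemma latin_filling i j : i < m -> j < m -> filling n (latin_block i j).
Proof.
move=> im jm.
have slt t v : shade n t v < n.
  rewrite /shade; case: t; first by rewrite ltn_mod.
  by rewrite (leq_ltn_trans (leq_subr _ _)) // prednK.
have sinj t v v' : shade n t v = shade n t v' -> v = v' %[mod n].
  have := ltn_pmod v n0; have := ltn_pmod v' n0.
  by rewrite /shade; case: t => //; lia.
split=> [k l kn ln|k l k' l' kn ln kn' ln']; rewrite /latin_block.
  have := slt (s i j) (p i * k + q i + (c + e) * (p' j * l + q' j)).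
  have := ltn_pmod (p i * k + q i + c * (p' j * l + q' j)) n0.
  by move: (shade _ _ _) (_ %% n); nia.
move=> E; have := E.
have X t : t %% n < n by rewrite ltn_mod.
(* From here on only the residues of [u] and [v] matter; the permutations are undone at the very
   end. *)
set u := p i * k + q i; set v := p' j * l + q' j.
set u' := p i * k' + q i; set v' := p' j * l' + q' j => {}E.
have E1 : u + c * v = u' + c * v' %[mod n].
  have := slt (s i j) (u + (c + e) * v); have := slt (s i j) (u' + (c + e) * v').
  by move: E (X (u + c * v)) (X (u' + c * v')); move: (shade _ _ _) (shade _ _ _); nia.
have E2 : u + (c + e) * v = u' + (c + e) * v' %[mod n].
  by apply: (sinj (s i j)); move: E; rewrite E1 => /addnI.
have vv : v = v' %[mod n].
  apply/eqP; rewrite -(eqn_mod_affine 0 _ _ en) !addn0 -(eqn_modDl (u + c * v)).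
  by rewrite -addnA -mulnDl E2 -[in X in _ == X]modnDml E1 modnDml -addnA -mulnDl.
have uu : u = u' %[mod n].
  apply/eqP; rewrite -(eqn_modDr (c * v)) E1 -modnDmr -modnMmr -vv modnMmr.
  by rewrite modnDmr.
by split; [exact: affine_inj (pn im) kn kn' uu|exact: affine_inj (pn' jm) ln ln' vv].
Qed.

Let rowE i j k l : latin_block i j k l =
  n * ((c * p' j * l + (p i * k + q i + c * q' j)) %% n) +
  shade n (s i j) ((c + e) * p' j * l + (p i * k + q i + (c + e) * q' j)).
Proof. by rewrite /latin_block; congr (n * (_ %% n) + shade n _ _); ring. Qed.

Let colE i j k l : latin_block i j k l =
  n * ((p i * k + (q i + c * (p' j * l + q' j))) %% n) +
  shade n (s i j) (p i * k + (q i + (c + e) * (p' j * l + q' j))).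
Proof. by rewrite /latin_block !addnA. Qed.

(** Inside each block the row is a Latin line, whose sum does not depend on the sign. For the
    squares, summing over $v$ instead of [l] removes every dependence on [j] except the sign, and
    the signs are balanced along row [i]. *)
Lemma latin_row i k : square m S Q A -> i < m -> \sum_(j < m) s i j = h ->
  mix m n S (n.+1 * sum1 n) latin_sq (A i) (fun j => latin_block i j k).
Proof.
move=> [_ Ar _ _ _] im sh; apply: (mix_const (Ar _ im)) => [j jm|].
  under eq_bigr => l _ do rewrite rowE.
  by apply: latin_line_sum; rewrite coprimeMl ?cn ?cen pn'.
pose F t l := (n * ((c * l + (p i * k + q i)) %% n) +
  shade n t ((c + e) * l + (p i * k + q i))) ^ 2.
pose G t := \sum_(l < n) F t l.
rewrite (eq_bigr (fun j : 'I_m => G (s i j))) => [|j _].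
  by rewrite (sum_balanced G mh sh) latin_line_sq.
(* The substitution $v = p'_j l + q'_j$, which is legitimate because [F] only sees $v$ mod [n]. *)
rewrite /G -(sum_affine (q' j) (F := F (s i j)) (pn' (ltn_ord j))) => [|v].
  apply: eq_bigr => l _; rewrite /F /latin_block.
  by rewrite [c * _ + _]addnC [(c + e) * _ + _]addnC.
rewrite /F; congr ((n * _ + _) ^ 2); first by rewrite -modnDml modnMmr modnDml.
by rewrite -shade_mod -modnDml modnMmr modnDml shade_mod.
Qed.

Lemma latin_col j l : square m S Q A -> j < m -> \sum_(i < m) s i j = h ->
  mix m n S (n.+1 * sum1 n) latin_sq (A^~ j) (fun i k => latin_block i j k l).
Proof.
move=> [_ _ Ac _ _] jm sh; apply: (mix_const (Ac _ jm)) => [i im|].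
  under eq_bigr => k _ do rewrite colE.
  by apply: latin_line_sum; rewrite pn.
(* The factor 1 only gives both digits the explicit slope that [latin_line_sq] expects. *)
pose F t k := (n * ((1 * k + c * (p' j * l + q' j)) %% n) +
  shade n t (1 * k + (c + e) * (p' j * l + q' j))) ^ 2.
pose G t := \sum_(k < n) F t k.
rewrite (eq_bigr (fun i : 'I_m => G (s i j))) => [|i _].
  by rewrite (sum_balanced (s := s^~ j) G mh sh) latin_line_sq ?coprime1n.
rewrite /G -(sum_affine (q i) (F := F (s i j)) (pn (ltn_ord i))) => [|v].
  by apply: eq_bigr => k _; rewrite /F /latin_block !mul1n.
rewrite /F !mul1n; congr ((n * _ + _) ^ 2); first by rewrite modnDml.
by rewrite -shade_mod modnDml shade_mod.
Qed.

(** The diagonals remain hypotheses since they are treated in two ways: by Latin lines for [n] prime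
    to 6, and by numerical verification for [n] equal to 3. *)
Lemma has_square_latin : square m S Q A ->
  (forall i, i < m -> \sum_(j < m) s i j = h) ->
  (forall j, j < m -> \sum_(i < m) s i j = h) ->
  mix m n S (n.+1 * sum1 n) latin_sq (fun i => A i i) (fun i k => latin_block i i k k) ->
  mix m n S (n.+1 * sum1 n) latin_sq (fun i => A i (m.-1 - i))
    (fun i k => latin_block i (m.-1 - i) k (n.-1 - k)) ->
  has_square (m * n).
Proof.
move=> hA sr sc hd ha; apply: (square_blocks n0 hA latin_filling) => //.
- by move=> i k im _; apply: latin_row (sr _ im).
- by move=> j l jm _; apply: latin_col (sc _ jm).
- exact: hd.
- exact: ha.
Qed.

End Latin.

(* For m = 2 mod 4, half of the entries are true in every row, every column and both diagonals.  A sign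
   matrix u_i v_j can only achieve this for 4 | m; here the first two rows follow another pattern. *)
Definition sgn (m i j : nat) : bool :=
  if i < 2 then (j < m./2) (+) (i == 1) else odd j (+) (1 < i %% 4).

Lemma sum_period4 (F : nat -> nat) t : (forall r, F (r %% 4) = F r) ->
  \sum_(r < t * 4) F r = t * (F 0 + F 1 + F 2 + F 3).
Proof.
move=> F4; have := sum_divmod t 4 (fun _ k => F k).
under eq_bigr => r _ do rewrite F4.
by move->; rewrite sum_nat_const card_ord !big_ord_recr big_ord0.
Qed.

(** * Balance of the sign pattern along rows, columns and diagonals *)

Section Sign.
Variables (m : nat).
Hypothesis m4 : m %% 4 = 2.

(** Indices 0 and 1 are exceptional; as [m] is 2 mod 4, the others form complete periods of length
    four, starting at index 2. *)
Let sum_shift (F : nat -> nat) : (forall r, F (r %% 4).+2 = F r.+2) ->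
  \sum_(r < m) F r = F 0 + F 1 + m %/ 4 * (F 2 + F 3 + F 4 + F 5).
Proof.
move=> F4; have -> : m = (m %/ 4 * 4).+2 by lia.
rewrite !big_ord_recl /= addnA; congr addn.
rewrite -(sum_period4 (F := fun r => F r.+2)) //.
by have -> : (m %/ 4 * 4).+2 %/ 4 = m %/ 4 by lia.
Qed.

Let odd_mod4 r : odd (r %% 4) = odd r.
Proof. by rewrite {2}(divn_eq r 4) oddD oddM andbF. Qed.

Let mod4_shift r : (r %% 4).+2 %% 4 = r.+2 %% 4.
Proof. by rewrite -addn2 modnDml addn2. Qed.

Let halfE : m./2 = 1 + m %/ 4 * 2. Proof. by lia. Qed.

Lemma sgn_row i : \sum_(j < m) sgn m i j = m./2.
Proof.
rewrite /sgn; case: (ltnP i 2) => i2 /=; last first.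
  rewrite (sum_shift (F := fun j => nat_of_bool (odd j (+) (1 < i %% 4)))) => [|r]; last by rewrite /= odd_mod4.
  by rewrite halfE /=; case: (1 < _).
rewrite -(big_mkord xpredT (fun j => (j < m./2) (+) (i == 1) : nat)).
have E : m = m./2 + m./2 by lia.
(* Each of the two exceptional rows is constant on the left and on the right half. *)
rewrite (@big_cat_nat _ _ _ m./2) //=; last by lia.
rewrite (eq_big_nat _ _ (F2 := fun=> (i == 0) : nat)) => [|j jm]; last by lia.
rewrite [X in _ + X](eq_big_nat _ _ (F2 := fun=> (i == 1) : nat)) => [|j jm]; last by lia.
rewrite !sum_nat_const_nat; lia.
Qed.

(** Rows 0 and 1 are complementary, so they add one true entry to each column. In every later period
    of four rows, two rows carry the parity of [j] and two its negation. *)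
Lemma sgn_col j : \sum_(i < m) sgn m i j = m./2.
Proof.
rewrite (sum_shift (F := fun i => nat_of_bool (sgn m i j))) => [|r]; last by rewrite /sgn /= mod4_shift.
by rewrite halfE /sgn /=; case: (j < _); case: (odd j).
Qed.

(** For [2 < m] column 1 lies in the left half, so the first two diagonal entries have opposite
    signs. After them the pattern true, false, false, true repeats. *)
Lemma sgn_diag : 2 < m -> \sum_(i < m) sgn m i i = m./2.
Proof.
move=> m2.
rewrite (sum_shift (F := fun i => nat_of_bool (sgn m i i))) => [|r]; last by rewrite /sgn /= mod4_shift odd_mod4.
by rewrite halfE /sgn /=; lia.
Qed.

Lemma sgn_anti : 2 < m -> \sum_(i < m) sgn m i (m.-1 - i) = m./2.
Proof.
(* Since [m] is even, [m.-1 - i] has the parity opposite to [i]; the last two columns lie in the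
   right half, which settles the first two rows. *)
move=> m2; have E (i : 'I_m) : sgn m i (m.-1 - i) =
    (if i < 2 then i == 1 :> nat else ~~ odd i (+) (1 < i %% 4)).
  rewrite /sgn; case: ifP => i2; first by lia.
  by have := ltn_ord i; lia.
under eq_bigr => i _ do rewrite E.
rewrite (sum_shift (F := fun i => nat_of_bool (if i < 2 then i == 1 else ~~ odd i (+) (1 < i %% 4)))) => [|r].
  by rewrite halfE.
by rewrite /= mod4_shift odd_mod4.
Qed.

End Sign.

(** * Factors prime to 6 *)

(** The parameters [c = 2] and [e = n - 4] give [c + e = n - 2], that is, slopes 2 and -2 mod [n],
    without permutations. The two digits have slopes 3 and -1 on the main diagonal, -1 and 3 on the
    antidiagonal, so 2, 3 and 4 must be units. *)
Lemma has_square_coprime6 m n : m %% 4 = 2 -> 2 < m -> 4 < n -> coprime n 6 ->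
  has_square m -> has_square (m * n).
Proof.
move=> m4 m2 n4 n6 [S [Q [A hA]]].
have n2 : coprime 2 n by rewrite coprime_sym (coprime_dvdr _ n6).
have n3 : coprime 3 n by rewrite coprime_sym (coprime_dvdr _ n6).
have np : coprime n.-1 n by rewrite coprime_sym coprimenP //; lia.
have odn : odd n by rewrite -coprime2n.
have nm2 : coprime (n - 2) n.
  have {2}-> : n = 2 + (n - 2) by lia.
  by rewrite /coprime gcdnDr -/(coprime _ _) coprimen2; lia.
have nm4 : coprime (n - 4) n.
  have {2}-> : n = 2 ^ 2 + (n - 4) by lia.
  by rewrite /coprime gcdnDr -/(coprime _ _) coprimeXr // coprimen2; lia.
have n24 : 2 + (n - 4) = n - 2 by lia.
have mh : m = m./2.*2 by lia.
(* A diagonal is treated like a row: the same Latin line in every block up to the sign, and balanced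
   signs. *)
have Adiag f a b a' b' (s : nat -> bool) (g : nat -> nat -> nat) :
    line m S Q f -> coprime a n -> coprime a' n -> \sum_(i < m) s i = m./2 ->
    (forall i k, k < n -> g i k = n * ((a * k + b) %% n) + shade n (s i) (a' * k + b')) ->
    mix m n S (n.+1 * sum1 n) (latin_sq m./2 n) f g.
  move=> hf an an' sh gE.
  have gE' i : \sum_(k < n) g i k = n.+1 * sum1 n.
    by rewrite -(latin_line_sum b b' an an' (s i)); apply: eq_bigr => k _; apply: gE.
  apply: (mix_const hf) => //.
  pose G t := \sum_(k < n) (n * ((a * k + b) %% n) + shade n t (a' * k + b')) ^ 2.
  rewrite (eq_bigr (fun i : 'I_m => G (s i))) => [|i _].
    by rewrite (sum_balanced G mh sh) latin_line_sq.
  by apply: eq_bigr => k _; rewrite gE.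
have [_ _ _ Ad Aa] := hA.
have n0 : 0 < n by lia.
(* The number [c] of copies of [n] to be added is given explicitly, so that each congruence becomes
   an equation between naturals. *)
have Pm (x y c : nat) : x + n * c = y -> x = y %[mod n] by move <-; rewrite addnC mulnC modnMDl.
have Ps x y t : x = y %[mod n] -> shade n t x = shade n t y by rewrite /shade => ->.
apply: (@has_square_latin m m./2 n 2 (n - 4) (fun=> 1) (fun=> 0) (fun=> 1) (fun=> 0) (sgn m) S Q A) => //;
  rewrite ?n24 ?coprime1n //.
- by move=> i _; apply: sgn_row.
- by move=> j _; apply: sgn_col.
- apply: (Adiag _ 3 0 n.-1 0 (fun i => sgn m i i)) => // [|i k kn]; first exact: sgn_diag.
  rewrite /latin_block n24; congr (n * _ + _); first by congr (_ %% n); lia.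
  apply: Ps; congr (_ %% n). nia.
(* Substituting $l = n-1-k$ and adding $kn$ turns $k + 2l$ into $(n-1)k + 2(n-1)$ and $k + (n-2)l$
   into $3k + (n-2)(n-1)$. *)
- apply: (Adiag _ n.-1 (2 * n.-1) 3 ((n - 2) * n.-1) (fun i => sgn m i (m.-1 - i))) => // [|i k kn].
    exact: sgn_anti.
  rewrite /latin_block n24; congr (n * _ + _).
    apply: (Pm _ _ k); nia.
  apply: Ps; apply: (Pm _ _ k); nia.
Qed.

(** * Explicit squares *)

Lemma to_natM a b : N.to_nat (N.mul a b) = N.to_nat a * N.to_nat b.
Proof. exact: N2Nat.inj_mul. Qed.

(** Binary integers and a plain fold over a list, a form that [vm_compute] evaluates quickly on the
    tables; [N.to_nat] carries the results back. *)
Definition sumN (n : nat) (F : nat -> N) : N := foldr (fun k s => N.add (F k) s) 0%num (iota 0 n).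

Lemma to_nat_sumN n F : N.to_nat (sumN n F) = \sum_(k < n) N.to_nat (F k).
Proof.
rewrite -(big_mkord xpredT (fun k => N.to_nat (F k))) /sumN /index_iota subn0.
by elim: (iota 0 n) => [|k s IH] /=; rewrite ?big_nil // big_cons N2Nat.inj_add IH.
Qed.

Definition lineN (n : nat) (S Q : N) (f : nat -> N) : bool :=
  (sumN n f == S) && (sumN n (fun k => N.mul (f k) (f k)) == Q).

Lemma lineP n S Q f : lineN n S Q f -> line n (N.to_nat S) (N.to_nat Q) (fun k => N.to_nat (f k)).
Proof.
case/andP=> /eqP<- /eqP<-; rewrite /line !to_nat_sumN; split=> //.
by apply: eq_bigr => k _; rewrite to_natM -mulnn.
Qed.

Definition entry (T : seq (seq N)) (i j : nat) : N := nth 0%num (nth [::] T i) j.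

(** Sorting all entries and comparing with 0, 1, 2, ... verifies the bound and injectivity together,
    without comparing pairs of cells. *)
Definition square_table (n : nat) (S Q : N) (T : seq (seq N)) : bool :=
  [&& size T == n, all (fun r => size r == n) T,
      sort N.leb (flatten T) == traject N.succ 0%num (n * n),
      all (fun i => lineN n S Q (entry T i) && lineN n S Q (entry T ^~ i)) (iota 0 n),
      lineN n S Q (fun i => entry T i i)
    & lineN n S Q (fun i => entry T i (n.-1 - i))].

Lemma nth_flatten_entry n T i j : all (fun r => size r == n) T -> i < size T -> j < n ->
  nth 0%num (flatten T) (i * n + j) = entry T i j.
Proof.
rewrite /entry; elim: T i => // r T IH [|i] /= /andP[/eqP rn Tn] iT jn.
  by rewrite nth_cat rn jn.
rewrite nth_cat rn mulSn -addnA ltnNge leq_addr /= addKn.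
exact: IH.
Qed.

Lemma map_to_nat_traject x n :
  [seq N.to_nat k | k <- traject N.succ x n] = iota (N.to_nat x) n.
Proof. by elim: n x => //= n IH x; rewrite IH N2Nat.inj_succ. Qed.

Lemma square_tableP n S Q T : square_table n S Q T ->
  square n (N.to_nat S) (N.to_nat Q) (fun i j => N.to_nat (entry T i j)).
Proof.
case/and5P=> /eqP sT rT /eqP ent /allP lin /andP[ld la].
have perm : perm_eq [seq N.to_nat k | k <- flatten T] (iota 0 (n * n)).
  by rewrite -(map_to_nat_traject 0%num) perm_map // -ent perm_sym perm_sort.
have szT : size (flatten T) = n * n.
  by rewrite -(size_map N.to_nat) (perm_size perm) size_iota.
have idx i j : i < n -> j < n -> i * n + j < n * n by nia.
(* The cell (i, j) is position [i * n + j] of the flattened table, so distinctness of the entries is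
   that of a permutation of [iota]. *)
have nthE i j : i < n -> j < n ->
    nth 0 [seq N.to_nat k | k <- flatten T] (i * n + j) = N.to_nat (entry T i j).
  move=> il jl; rewrite (nth_map 0%num) ?szT ?idx //.
  by rewrite nth_flatten_entry ?sT.
split.
- split=> [i j il jl|i j i' j' il jl il' jl'].
    have : N.to_nat (entry T i j) \in iota 0 (n * n).
      by rewrite -(perm_mem perm) -nthE // mem_nth // size_map szT idx.
    by rewrite mem_iota mulnn.
  rewrite -!nthE // => /eqP; rewrite nth_uniq ?size_map ?szT ?idx //; last first.
    by rewrite (perm_uniq perm) iota_uniq.
  move/eqP => e; have n0 : 0 < n by lia.
  (* Quotient and remainder of the common position give back the two indices. *)
  have := congr1 (divn^~ n) e; have := congr1 (modn^~ n) e.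
  by rewrite /= !modnMDl !divnMDl // !divn_small // !modn_small // !addn0.
- by move=> i il; have /andP[/lineP] : lineN n S Q (entry T i) && lineN n S Q (entry T ^~ i)
    by apply: lin; rewrite mem_iota.
- by move=> i il; have /andP[_ /lineP] : lineN n S Q (entry T i) && lineN n S Q (entry T ^~ i)
    by apply: lin; rewrite mem_iota.
- exact: lineP ld.
- exact: lineP la.
Qed.

(** * The factor 3: diagonal conditions decided by computation *)

(** Block entries reach this test from [nat] through [N.of_nat]; in the application they are at most
    8, so the conversion is cheap, while the table entries are binary throughout. *)
Definition mixN (m n : nat) (S r R : N) (f : nat -> N) (g : nat -> nat -> N) : bool :=
  [&& sumN m (fun i => sumN n (g i)) == N.mul (N.of_nat m) r,
      sumN m (fun i => N.mul (f i) (sumN n (g i))) == N.mul r S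
    & sumN m (fun i => sumN n (fun k => N.mul (g i k) (g i k))) == R].

Lemma mixP m n S r R f (g : nat -> nat -> nat) :
  mixN m n S r R f (fun i k => N.of_nat (g i k)) ->
  mix m n (N.to_nat S) (N.to_nat r) (N.to_nat R) (fun i => N.to_nat (f i)) g.
Proof.
have sumE (F : nat -> nat) : N.to_nat (sumN n (fun k => N.of_nat (F k))) = \sum_(k < n) F k.
  by rewrite to_nat_sumN; apply: eq_bigr => k _; rewrite Nat2N.id.
case/and3P=> /eqP/(congr1 N.to_nat) e1 /eqP/(congr1 N.to_nat) e2 /eqP/(congr1 N.to_nat) e3.
move: e1 e2 e3; rewrite !to_nat_sumN !to_natM Nat2N.id => e1 e2 e3; split.
- by rewrite -e1; apply: eq_bigr => i _; rewrite sumE.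
- by rewrite -e2; apply: eq_bigr => i _; rewrite to_natM sumE.
- rewrite -e3; apply: eq_bigr => i _; rewrite to_nat_sumN; apply: eq_bigr => k _.
  by rewrite to_natM Nat2N.id mulnn.
Qed.

(* A code 3a + b with a < 2 and b < 3 stands for the permutation k |-> (a+1) k + b of Z/3; all six
   permutations are of this form. *)
Definition scale (e : seq nat) (i : nat) := (nth 0 e i %/ 3).+1.
Definition shift (e : seq nat) (i : nat) := nth 0 e i %% 3.

(** The digits are $u + v$ and $u + 2v$ mod 3. All slopes being 1 or -1 mod 3, on each diagonal of
    each block one of these two is constant, whatever the codes. A single block thus has no Latin
    diagonal, and only the total over all blocks of a diagonal can be balanced. *)
Definition triple_block (m : nat) (e e' : seq nat) :=
  latin_block 3 1 1 (scale e) (shift e) (scale e') (shift e') (sgn m).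

(* 12 and 136 are the values at n = 3 of the constants of has_square_latin. *)
Definition triple_codes (m : nat) (S : N) (T : seq (seq N)) (e e' : seq nat) : bool :=
  [&& all (gtn 6) e, all (gtn 6) e',
      mixN m 3 S 12 (N.of_nat m./2 * 136) (fun i => entry T i i)
        (fun i k => N.of_nat (triple_block m e e' i i k k))
    & mixN m 3 S 12 (N.of_nat m./2 * 136) (fun i => entry T i (m.-1 - i))
        (fun i k => N.of_nat (triple_block m e e' i (m.-1 - i) k (2 - k)))]%num.

(** Scales 1 and 2 are prime to 3, so rows and columns are covered by the Latin argument for any
    codes; the two diagonal conditions are those tested by [triple_codes]. *)
Lemma has_square_triple m S Q T e e' : m %% 4 = 2 -> 2 < m ->
  square_table m S Q T -> triple_codes m S T e e' -> has_square (m * 3).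
Proof.
move=> m4 m2 /square_tableP hA /and4P[e6 e6' /mixP hd /mixP ha].
have cop d i : all (gtn 6) d -> coprime (scale d i) 3.
  move=> /allP d6; rewrite /scale; have : nth 0 d i < 6.
    (* Beyond the end of the list the default code 0 is the identity permutation. *)
    by case: (ltnP i (size d)) => h; [apply/d6/mem_nth|rewrite nth_default].
  by case: (nth 0 d i) => [|[|[|[|[|[|]]]]]].
have sum3 : 4 * sum1 3 = 12 by rewrite /sum1 !big_ord_recr big_ord0.
have sq3 : latin_sq m./2 3 = m./2 * 136.
  by rewrite /latin_sq /sum1 /sum2 !big_ord_recr !big_ord0.
move: hd ha; rewrite to_natM Nat2N.id -[N.to_nat 136]/136 -sq3 -[N.to_nat 12]/12 -sum3 => hd ha.
apply: (has_square_latin (s := sgn m) _ _ _ _ _ _ _ hA _ _ hd ha) => //.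
- by lia.
- by move=> i _; apply: cop.
- by move=> i _; apply: cop.
- by move=> i _; apply: sgn_row.
- by move=> i _; apply: sgn_col.
Qed.

Lemma has_square_table n S Q T : square_table n S Q T -> has_square n.
Proof. by move/square_tableP; exists (N.to_nat S), (N.to_nat Q); eexists; eassumption. Qed.

(** * Tables of bimagic squares, with permutation codes for tripling *)

Definition table9 : seq (seq N) := [::
  [:: 0; 31; 62; 75; 25; 47; 42; 64; 14];
  [:: 73; 23; 51; 40; 71; 9; 7; 29; 57];
  [:: 38; 66; 16; 5; 33; 55; 80; 18; 49];
  [:: 26; 45; 76; 65; 12; 43; 32; 60; 1];
  [:: 69; 10; 41; 27; 58; 8; 21; 52; 74];
  [:: 34; 56; 3; 19; 50; 78; 67; 17; 36];
  [:: 13; 44; 63; 61; 2; 30; 46; 77; 24];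
  [:: 59; 6; 28; 53; 72; 22; 11; 39; 70];
  [:: 48; 79; 20; 15; 37; 68; 54; 4; 35]]%num.

(** The constants, here and for the later tables, are the sums of 0, ..., $n^2-1$ and of their
    squares divided by the number of rows: $n(n^2-1)/2$ and $n(n^2-1)(2n^2-1)/6$. *)
Lemma square_table9 : square_table 9 360 19320 table9.
Proof. by vm_compute. Qed.

(** No codes accompany this table: order 30 has a table of its own. *)
Definition table10 : seq (seq N) := [::
  [:: 24; 62; 45; 11; 59; 33; 71; 95; 8; 87];
  [:: 19; 57; 79; 0; 35; 81; 90; 67; 20; 47];
  [:: 53; 93; 18; 39; 40; 4; 65; 21; 89; 73];
  [:: 98; 1; 30; 66; 72; 80; 49; 54; 17; 28];
  [:: 32; 76; 52; 68; 94; 29; 14; 3; 44; 83];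
  [:: 70; 6; 16; 82; 99; 46; 22; 69; 34; 51];
  [:: 56; 74; 12; 25; 37; 41; 97; 61; 85; 7];
  [:: 2; 58; 84; 48; 23; 91; 13; 38; 60; 78];
  [:: 86; 26; 96; 64; 9; 75; 43; 10; 50; 36];
  [:: 55; 42; 63; 92; 27; 15; 31; 77; 88; 5]]%num.

Lemma square_table10 : square_table 10 495 32835 table10.
Proof. by vm_compute. Qed.

Definition table14 : seq (seq N) := [::
  [:: 162; 110; 124; 86; 144; 186; 127; 177; 31; 78; 22; 5; 51; 62];
  [:: 103; 129; 96; 158; 55; 14; 171; 72; 123; 69; 4; 143; 35; 193];
  [:: 37; 130; 100; 91; 191; 140; 74; 2; 161; 180; 54; 26; 120; 59];
  [:: 15; 132; 53; 67; 3; 29; 182; 165; 81; 168; 106; 152; 97; 115];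
  [:: 13; 93; 109; 187; 174; 28; 21; 45; 114; 164; 63; 73; 136; 145];
  [:: 71; 16; 36; 175; 157; 138; 44; 8; 185; 68; 116; 111; 92; 148];
  [:: 85; 178; 184; 80; 48; 58; 6; 108; 39; 139; 117; 151; 154; 18];
  [:: 183; 122; 155; 137; 32; 61; 82; 146; 11; 42; 89; 181; 19; 105];
  [:: 84; 17; 190; 99; 56; 167; 121; 147; 52; 41; 170; 131; 83; 7];
  [:: 112; 64; 50; 0; 150; 176; 126; 95; 102; 25; 38; 75; 189; 163];
  [:: 141; 188; 1; 87; 76; 60; 135; 49; 107; 40; 179; 24; 119; 159];
  [:: 156; 133; 149; 33; 57; 125; 90; 101; 172; 192; 79; 23; 9; 46];
  [:: 169; 10; 30; 153; 104; 113; 20; 77; 160; 94; 194; 128; 66; 47];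
  [:: 34; 43; 88; 12; 118; 70; 166; 173; 27; 65; 134; 142; 195; 98]]%num.

Lemma square_table14 : square_table 14 1365 177905 table14.
Proof. by vm_compute. Qed.

(** The diagonals meet only the blocks (i, i) and (i, m-1-i), so codes interact in groups of two
    rows and two columns, those with indices i and m-1-i. In each group the row of smaller index
    keeps the identity, here and for the later orders; the other three codes leave enough freedom to
    balance the diagonals. *)
Definition row_codes14 : seq nat :=
  nseq 7 0 ++
  [:: 3; 1; 1; 2; 1; 0; 4].

Definition col_codes14 : seq nat :=
  [:: 0; 1; 3; 5; 1; 1; 1; 3; 3; 3; 0; 5; 0; 5].

Lemma triple_codes14 : triple_codes 14 1365 table14 row_codes14 col_codes14.
Proof. by vm_compute. Qed.

Definition table18 : seq (seq N) := [::
  [:: 190; 7; 92; 164; 158; 260; 142; 47; 321; 88; 289; 122; 204; 283; 60; 240; 21; 219];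
  [:: 109; 183; 99; 64; 319; 3; 246; 274; 206; 72; 288; 178; 32; 264; 161; 225; 136; 48];
  [:: 282; 244; 39; 14; 200; 94; 28; 263; 111; 294; 173; 188; 74; 71; 312; 141; 146; 233];
  [:: 93; 33; 121; 280; 245; 213; 135; 85; 56; 2; 217; 162; 191; 255; 310; 154; 305; 50];
  [:: 215; 157; 243; 276; 62; 138; 10; 186; 313; 82; 23; 228; 108; 292; 171; 262; 96; 45];
  [:: 59; 311; 287; 22; 207; 87; 197; 112; 241; 133; 291; 90; 174; 16; 149; 231; 256; 44];
  [:: 80; 145; 232; 100; 271; 320; 58; 254; 139; 176; 293; 12; 187; 52; 114; 209; 18; 247];
  [:: 97; 211; 196; 281; 4; 144; 30; 295; 43; 179; 79; 69; 314; 224; 115; 239; 257; 130];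
  [:: 63; 208; 9; 41; 131; 181; 265; 34; 235; 300; 110; 322; 222; 101; 89; 279; 150; 167];
  [:: 24; 129; 107; 202; 40; 175; 290; 57; 148; 318; 120; 229; 266; 182; 238; 17; 284; 81];
  [:: 198; 286; 242; 134; 153; 180; 226; 168; 124; 259; 66; 317; 296; 5; 51; 25; 73; 104];
  [:: 194; 156; 270; 251; 119; 201; 105; 1; 61; 75; 127; 169; 31; 269; 299; 221; 49; 309];
  [:: 116; 103; 323; 163; 70; 20; 193; 252; 128; 273; 147; 15; 230; 46; 297; 77; 205; 249];
  [:: 304; 267; 212; 278; 227; 6; 91; 234; 65; 38; 86; 152; 177; 132; 35; 113; 184; 306];
  [:: 275; 26; 54; 143; 308; 106; 237; 155; 261; 172; 36; 8; 84; 210; 220; 117; 192; 303];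
  [:: 42; 223; 165; 126; 195; 250; 102; 78; 302; 203; 307; 277; 11; 123; 67; 19; 258; 159];
  [:: 298; 0; 27; 83; 185; 214; 316; 272; 98; 125; 160; 170; 253; 216; 68; 37; 248; 137];
  [:: 268; 218; 189; 285; 13; 315; 236; 140; 55; 118; 95; 199; 53; 166; 151; 301; 29; 76]]%num.

Lemma square_table18 : square_table 18 2907 626943 table18.
Proof. by vm_compute. Qed.

Definition row_codes18 : seq nat :=
  nseq 9 0 ++
  [:: 5; 2; 0; 1; 5; 0; 5; 2; 3].

Definition col_codes18 : seq nat :=
  [:: 1; 1; 5; 1; 4; 1; 4; 3; 0; 0; 1; 3; 3; 1; 2; 4; 3; 3].

Lemma triple_codes18 : triple_codes 18 2907 table18 row_codes18 col_codes18.
Proof. by vm_compute. Qed.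

Definition table22 : seq (seq N) := [::
  [:: 298; 374; 417; 3; 257; 330; 164; 45; 132; 190; 127; 315; 218; 438; 109; 362; 72; 470; 281; 41;
     444; 226];
  [:: 80; 469; 120; 155; 57; 392; 302; 277; 429; 332; 370; 7; 91; 314; 212; 409; 153; 253; 178; 237;
     443; 33];
  [:: 88; 422; 366; 331; 81; 291; 482; 312; 14; 191; 129; 460; 405; 142; 231; 209; 251; 50; 276; 42;
     386; 154];
  [:: 419; 415; 352; 248; 75; 197; 16; 283; 48; 453; 338; 22; 241; 169; 384; 119; 202; 303; 467;
     146; 95; 321];
  [:: 40; 293; 5; 393; 185; 200; 156; 98; 269; 320; 227; 452; 412; 242; 86; 150; 365; 116; 65; 480;
     426; 333];
  [:: 407; 168; 135; 371; 43; 60; 389; 245; 284; 105; 313; 288; 336; 15; 76; 117; 477; 451; 222;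
     177; 198; 436];
  [:: 404; 421; 110; 104; 448; 343; 234; 378; 136; 55; 369; 323; 35; 468; 70; 306; 261; 274; 181;
     214; 4; 175];
  [:: 58; 112; 473; 433; 300; 380; 260; 145; 316; 413; 344; 78; 100; 279; 236; 354; 440; 27; 211;
     184; 161; 9];
  [:: 99; 240; 163; 425; 267; 442; 20; 69; 347; 385; 411; 250; 28; 219; 372; 326; 44; 111; 465; 287;
     194; 149];
  [:: 309; 266; 355; 124; 351; 54; 445; 230; 84; 10; 152; 103; 160; 36; 395; 410; 299; 199; 483;
     176; 428; 244];
  [:: 310; 79; 341; 301; 139; 128; 368; 479; 13; 228; 167; 201; 458; 183; 403; 431; 377; 52; 252;
     268; 39; 96];
  [:: 174; 82; 294; 339; 430; 56; 229; 1; 126; 454; 30; 216; 187; 246; 379; 133; 280; 397; 102; 481;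
     353; 324];
  [:: 114; 383; 77; 94; 272; 398; 450; 144; 478; 172; 8; 208; 373; 221; 322; 182; 63; 296; 37; 427;
     249; 345];
  [:: 196; 29; 123; 203; 271; 262; 49; 364; 159; 89; 21; 420; 307; 414; 318; 85; 464; 388; 337; 223;
     134; 457];
  [:: 286; 17; 270; 224; 73; 472; 166; 416; 308; 247; 359; 180; 435; 53; 106; 34; 342; 456; 143;
     387; 122; 217];
  [:: 408; 113; 265; 205; 147; 90; 346; 295; 232; 446; 38; 165; 328; 363; 259; 47; 19; 189; 74; 439;
     463; 382];
  [:: 423; 162; 367; 476; 304; 0; 376; 235; 131; 97; 447; 87; 137; 401; 193; 285; 254; 334; 24; 210;
     319; 51];
  [:: 375; 329; 12; 115; 335; 138; 297; 31; 455; 239; 273; 434; 207; 71; 406; 466; 107; 46; 192;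
     171; 258; 356];
  [:: 83; 325; 225; 59; 424; 118; 92; 391; 357; 441; 400; 158; 471; 195; 6; 278; 349; 256; 305; 25;
     140; 215];
  [:: 61; 289; 358; 394; 32; 275; 66; 121; 350; 213; 243; 148; 179; 317; 475; 402; 233; 101; 449;
     432; 157; 18];
  [:: 399; 263; 67; 290; 348; 360; 220; 462; 390; 108; 151; 437; 64; 459; 264; 2; 23; 204; 188; 173;
     130; 311];
  [:: 282; 62; 418; 26; 474; 327; 186; 292; 255; 125; 396; 361; 141; 68; 11; 206; 238; 340; 381; 93;
     170; 461]]%num.

Lemma square_table22 : square_table 22 5313 1712557 table22.
Proof. by vm_compute. Qed.

Definition row_codes22 : seq nat :=
  nseq 11 0 ++
  [:: 1; 2; 5; 3; 2; 4; 1; 3; 4; 3; 1].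

Definition col_codes22 : seq nat :=
  [:: 3; 0; 5; 0; 2; 1; 4; 2; 2; 4; 5; 4; 4; 1; 5; 5; 2; 0; 1; 3; 0; 4].

Lemma triple_codes22 : triple_codes 22 5313 table22 row_codes22 col_codes22.
Proof. by vm_compute. Qed.

Definition table26 : seq (seq N) := [::
  [:: 552; 78; 441; 242; 131; 198; 413; 601; 173; 120; 232; 269; 372; 301; 61; 455; 332; 480; 544;
     580; 13; 517; 339; 631; 41; 659];
  [:: 257; 200; 293; 95; 634; 499; 211; 137; 590; 374; 469; 404; 620; 437; 335; 358; 20; 261; 56;
     31; 563; 667; 445; 124; 521; 174];
  [:: 195; 69; 356; 423; 390; 160; 545; 477; 264; 621; 331; 578; 566; 243; 385; 311; 630; 125; 443;
     665; 148; 10; 498; 85; 219; 38];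
  [:: 35; 603; 444; 354; 559; 52; 585; 247; 488; 624; 536; 302; 439; 670; 23; 133; 170; 505; 394;
     83; 186; 231; 330; 386; 268; 128];
  [:: 93; 348; 452; 213; 121; 625; 657; 33; 400; 8; 142; 57; 481; 306; 201; 434; 583; 283; 326; 165;
     519; 252; 616; 527; 562; 371];
  [:: 206; 551; 494; 112; 399; 100; 221; 299; 254; 641; 435; 262; 163; 540; 668; 607; 388; 478; 454;
     18; 59; 584; 26; 343; 149; 324];
  [:: 575; 355; 245; 99; 214; 487; 15; 300; 28; 333; 155; 509; 550; 467; 193; 171; 534; 379; 54;
     110; 609; 421; 280; 626; 674; 392];
  [:: 496; 180; 9; 636; 203; 622; 567; 592; 230; 651; 442; 468; 240; 96; 391; 315; 105; 58; 278;
     440; 307; 535; 381; 359; 44; 130];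
  [:: 147; 352; 524; 250; 81; 653; 546; 319; 76; 123; 497; 294; 602; 265; 438; 490; 384; 228; 29;
     597; 194; 462; 646; 402; 175; 1];
  [:: 42; 106; 493; 599; 84; 389; 529; 663; 579; 271; 152; 346; 22; 510; 162; 414; 451; 568; 644;
     296; 227; 74; 417; 317; 184; 236];
  [:: 475; 368; 279; 656; 416; 449; 564; 518; 537; 334; 229; 72; 140; 187; 619; 297; 357; 43; 157;
     253; 639; 398; 116; 89; 7; 576];
  [:: 276; 615; 224; 650; 637; 401; 286; 40; 512; 560; 461; 111; 541; 16; 138; 77; 164; 362; 323;
     238; 429; 197; 574; 484; 380; 79];
  [:: 513; 649; 104; 161; 284; 482; 63; 654; 340; 569; 533; 143; 465; 202; 47; 604; 102; 290; 407;
     249; 313; 581; 12; 419; 220; 369];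
  [:: 226; 289; 548; 169; 489; 632; 277; 235; 312; 376; 80; 460; 409; 207; 361; 65; 431; 139; 588;
     49; 6; 501; 117; 611; 660; 538];
  [:: 422; 647; 555; 97; 108; 24; 506; 375; 345; 295; 251; 327; 60; 223; 658; 134; 459; 587; 159;
     204; 623; 403; 531; 46; 266; 470];
  [:: 153; 234; 101; 652; 605; 292; 320; 260; 466; 181; 55; 426; 353; 629; 511; 593; 48; 539; 491;
     113; 410; 2; 367; 205; 208; 561];
  [:: 215; 485; 64; 347; 448; 183; 608; 514; 32; 248; 126; 303; 25; 635; 136; 408; 156; 103; 275;
     582; 377; 558; 675; 318; 522; 432];
  [:: 321; 450; 612; 241; 373; 178; 217; 145; 547; 71; 5; 91; 532; 363; 412; 192; 672; 642; 310;
     418; 507; 109; 272; 39; 573; 483];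
  [:: 11; 172; 34; 500; 88; 396; 305; 610; 199; 258; 594; 471; 427; 648; 114; 655; 366; 141; 68;
     542; 222; 282; 322; 456; 556; 338];
  [:: 387; 472; 216; 309; 281; 425; 237; 166; 87; 350; 189; 3; 107; 154; 526; 570; 671; 600; 627;
     457; 596; 75; 328; 393; 504; 45];
  [:: 520; 210; 188; 453; 239; 151; 86; 589; 553; 492; 614; 666; 436; 129; 640; 19; 287; 36; 66;
     397; 267; 365; 179; 515; 341; 337];
  [:: 336; 82; 486; 298; 525; 256; 30; 191; 633; 586; 122; 516; 209; 135; 458; 395; 177; 613; 351;
     549; 70; 424; 14; 664; 370; 285];
  [:: 673; 325; 571; 185; 233; 420; 382; 273; 643; 288; 406; 598; 90; 447; 244; 146; 62; 473; 168;
     503; 577; 21; 543; 37; 349; 118];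
  [:: 415; 27; 661; 115; 618; 17; 246; 94; 176; 150; 645; 591; 274; 190; 430; 523; 495; 304; 364;
     474; 212; 464; 316; 344; 73; 557];
  [:: 662; 638; 67; 291; 565; 182; 51; 225; 144; 119; 595; 508; 98; 158; 428; 4; 476; 411; 530; 329;
     342; 259; 378; 263; 446; 606];
  [:: 572; 270; 314; 628; 50; 502; 308; 218; 167; 132; 479; 0; 554; 617; 196; 405; 255; 127; 669;
     433; 360; 383; 53; 92; 463; 528]]%num.

Lemma square_table26 : square_table 26 8775 3951675 table26.
Proof. by vm_compute. Qed.

Definition row_codes26 : seq nat :=
  nseq 13 0 ++
  [:: 3; 2; 2; 5; 3; 3; 4; 5; 2; 4; 1; 5; 5].

Definition col_codes26 : seq nat :=
  [:: 3; 5; 3; 5; 1; 3; 0; 1; 5; 0; 4; 4; 2; 3; 0; 5; 5; 2; 4; 1; 5; 2; 0; 2; 1; 2].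

Lemma triple_codes26 : triple_codes 26 8775 table26 row_codes26 col_codes26.
Proof. by vm_compute. Qed.

(** No codes here either: order 90 is the product of 10 and 9. *)
Definition table30 : seq (seq N) := [::
  [:: 44; 2; 338; 637; 376; 94; 675; 436; 548; 873; 614; 62; 403; 232; 530; 700; 146; 194; 509; 768;
     313; 254; 287; 595; 178; 853; 838; 780; 472; 734];
  [:: 590; 748; 66; 630; 318; 705; 378; 53; 152; 3; 112; 846; 141; 290; 401; 456; 523; 196; 794;
     264; 222; 604; 826; 420; 556; 887; 763; 684; 505; 352];
  [:: 173; 649; 48; 871; 829; 587; 374; 685; 786; 699; 133; 324; 242; 195; 747; 273; 224; 491; 432;
     857; 396; 19; 544; 772; 622; 347; 535; 95; 84; 452];
  [:: 478; 828; 385; 68; 611; 23; 710; 292; 49; 756; 228; 349; 184; 153; 121; 489; 304; 656; 259;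
     525; 841; 745; 442; 392; 689; 570; 108; 562; 870; 798];
  [:: 879; 262; 538; 239; 176; 130; 716; 18; 451; 71; 329; 609; 294; 864; 648; 367; 91; 784; 579;
     484; 330; 820; 561; 190; 731; 38; 666; 407; 437; 776];
  [:: 852; 503; 563; 896; 193; 463; 76; 371; 54; 400; 696; 258; 577; 123; 807; 340; 730; 529; 233;
     426; 682; 835; 631; 170; 27; 306; 616; 104; 270; 754];
  [:: 308; 583; 165; 671; 627; 365; 522; 893; 793; 547; 405; 140; 483; 715; 299; 641; 849; 37; 735;
     248; 354; 96; 183; 21; 474; 449; 82; 223; 827; 750];
  [:: 431; 274; 342; 660; 388; 118; 892; 720; 610; 122; 251; 766; 809; 861; 824; 174; 56; 714; 192;
     398; 511; 238; 63; 559; 16; 473; 582; 311; 486; 644];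
  [:: 386; 762; 458; 137; 480; 743; 29; 355; 423; 305; 253; 646; 898; 817; 531; 859; 692; 406; 186;
     678; 592; 603; 803; 150; 286; 41; 102; 546; 88; 230];
  [:: 866; 351; 832; 75; 723; 421; 765; 369; 156; 390; 26; 288; 634; 466; 687; 35; 492; 584; 706;
     541; 625; 327; 211; 781; 536; 116; 188; 888; 268; 138];
  [:: 58; 574; 519; 775; 226; 331; 202; 454; 379; 117; 620; 797; 446; 142; 1; 72; 161; 633; 411;
     679; 557; 713; 840; 496; 243; 725; 314; 889; 836; 275];
  [:: 712; 440; 7; 767; 450; 177; 412; 356; 360; 481; 819; 789; 872; 64; 686; 309; 851; 45; 97; 266;
     655; 191; 586; 227; 295; 560; 517; 619; 739; 136];
  [:: 368; 269; 751; 218; 676; 551; 581; 810; 167; 526; 348; 738; 504; 651; 99; 272; 899; 394; 198;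
     693; 424; 144; 602; 40; 808; 8; 863; 477; 317; 89];
  [:: 148; 332; 680; 235; 70; 366; 550; 654; 240; 697; 895; 617; 823; 515; 180; 721; 598; 171; 494;
     427; 282; 46; 479; 844; 779; 312; 415; 100; 790; 25];
  [:: 618; 249; 13; 640; 825; 868; 213; 897; 672; 391; 761; 205; 87; 271; 796; 518; 455; 724; 335;
     107; 701; 588; 172; 447; 36; 554; 323; 382; 149; 488];
  [:: 476; 244; 175; 143; 691; 869; 533; 628; 567; 886; 389; 416; 297; 333; 669; 181; 635; 110; 301;
     215; 14; 802; 80; 758; 728; 33; 576; 433; 490; 813];
  [:: 652; 867; 623; 120; 377; 234; 799; 279; 507; 321; 417; 578; 757; 874; 4; 665; 430; 65; 811;
     31; 201; 115; 462; 353; 703; 521; 179; 545; 255; 740];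
  [:: 667; 337; 647; 428; 621; 187; 20; 727; 847; 73; 875; 792; 397; 57; 777; 168; 485; 564; 93;
     834; 125; 231; 471; 263; 719; 320; 534; 278; 573; 375];
  [:: 606; 359; 220; 189; 10; 160; 418; 662; 818; 256; 653; 315; 891; 362; 495; 510; 806; 467; 856;
     736; 86; 597; 42; 555; 289; 698; 439; 755; 132; 103];
  [:: 225; 296; 438; 404; 32; 608; 520; 98; 690; 839; 543; 502; 61; 760; 363; 126; 267; 650; 855;
     326; 593; 203; 350; 469; 795; 683; 159; 722; 880; 28];
  [:: 246; 876; 528; 506; 154; 336; 217; 51; 596; 200; 718; 79; 605; 303; 373; 785; 435; 470; 778;
     822; 92; 737; 848; 663; 291; 145; 12; 566; 639; 414];
  [:: 155; 59; 77; 129; 658; 726; 882; 764; 788; 443; 113; 219; 281; 565; 393; 831; 694; 247; 459;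
     208; 860; 508; 516; 9; 334; 612; 681; 302; 387; 585];
  [:: 135; 752; 345; 498; 801; 881; 674; 383; 744; 445; 645; 537; 708; 210; 199; 241; 607; 316; 83;
     5; 111; 540; 833; 402; 162; 589; 280; 845; 50; 464];
  [:: 883; 372; 733; 169; 632; 599; 465; 499; 670; 830; 11; 552; 257; 395; 285; 310; 601; 513; 843;
     131; 800; 357; 101; 85; 774; 229; 197; 34; 441; 717];
  [:: 434; 158; 413; 711; 114; 688; 67; 461; 341; 204; 638; 572; 39; 370; 549; 885; 237; 854; 139;
     514; 260; 816; 493; 787; 276; 322; 742; 6; 769; 626];
  [:: 453; 749; 783; 429; 884; 568; 707; 361; 293; 399; 78; 319; 594; 615; 164; 106; 207; 812; 532;
     497; 221; 127; 22; 850; 643; 673; 773; 344; 30; 252];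
  [:: 185; 119; 805; 613; 346; 47; 166; 81; 0; 468; 732; 147; 245; 636; 575; 307; 677; 277; 524;
     862; 877; 569; 702; 380; 448; 815; 771; 487; 408; 216];
  [:: 105; 865; 422; 284; 157; 741; 410; 629; 209; 814; 460; 878; 500; 343; 261; 791; 134; 15; 384;
     52; 512; 580; 642; 709; 60; 325; 212; 668; 553; 770];
  [:: 695; 482; 842; 804; 659; 328; 457; 24; 74; 664; 425; 128; 250; 894; 163; 600; 109; 746; 43;
     591; 358; 419; 542; 759; 283; 837; 236; 364; 182; 527];
  [:: 657; 124; 729; 539; 381; 571; 55; 475; 501; 265; 298; 17; 206; 409; 858; 753; 90; 821; 624;
     300; 890; 661; 151; 339; 704; 444; 782; 69; 558; 214]]%num.

Lemma square_table30 : square_table 30 13485 8086505 table30.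
Proof. by vm_compute. Qed.

Definition table34 : seq (seq N) := [::
  [:: 305; 666; 623; 957; 221; 1048; 165; 312; 544; 919; 110; 34; 423; 1071; 1114; 877; 202; 762;
     360; 1155; 704; 887; 20; 460; 377; 824; 100; 583; 495; 810; 1010; 716; 521; 260];
  [:: 602; 914; 570; 961; 76; 210; 1136; 263; 126; 195; 400; 504; 444; 700; 676; 143; 834; 510; 927;
     1098; 642; 297; 729; 787; 1050; 359; 53; 3; 990; 770; 306; 872; 1058; 430];
  [:: 59; 381; 191; 324; 998; 1143; 962; 292; 120; 561; 237; 157; 468; 936; 511; 792; 727; 627; 868;
     835; 693; 599; 73; 349; 1055; 415; 1038; 259; 679; 10; 917; 1119; 483; 757];
  [:: 342; 4; 604; 457; 554; 528; 396; 973; 155; 1029; 426; 661; 814; 996; 69; 58; 706; 830; 132;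
     301; 638; 1145; 772; 728; 216; 1084; 315; 924; 852; 261; 186; 902; 487; 1090];
  [:: 164; 303; 134; 1063; 1105; 1; 184; 421; 600; 1000; 41; 870; 82; 512; 508; 678; 397; 1152; 309;
     779; 894; 247; 806; 1025; 685; 643; 816; 455; 214; 368; 550; 944; 952; 733];
  [:: 253; 746; 8; 388; 705; 224; 112; 344; 443; 43; 1129; 668; 1066; 197; 605; 788; 300; 323; 750;
     494; 137; 534; 861; 98; 438; 1005; 828; 1107; 929; 633; 985; 908; 558; 1028];
  [:: 403; 833; 1127; 75; 618; 686; 598; 1096; 427; 169; 649; 29; 1078; 44; 248; 730; 308; 471; 866;
     219; 895; 780; 971; 481; 117; 171; 542; 287; 366; 1019; 569; 930; 1044; 789];
  [:: 697; 474; 205; 804; 959; 304; 839; 1047; 724; 88; 526; 354; 1130; 949; 410; 1008; 588; 54;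
     1083; 549; 33; 1100; 262; 499; 884; 153; 174; 103; 858; 763; 657; 407; 310; 640];
  [:: 948; 258; 332; 1053; 699; 382; 1108; 1073; 753; 1132; 428; 624; 845; 350; 726; 135; 232; 293;
     901; 83; 447; 479; 987; 152; 55; 595; 659; 879; 552; 981; 175; 22; 513; 784];
  [:: 116; 523; 405; 988; 696; 582; 19; 503; 273; 163; 212; 432; 546; 741; 193; 933; 898; 57; 240;
     1081; 448; 963; 800; 674; 613; 1049; 860; 322; 843; 765; 353; 96; 1133; 1115];
  [:: 393; 345; 785; 671; 107; 1146; 855; 1033; 203; 149; 27; 1121; 837; 522; 463; 999; 720; 1086;
     281; 320; 425; 557; 941; 594; 620; 489; 62; 246; 81; 703; 958; 777; 885; 234];
  [:: 1111; 378; 535; 637; 1015; 435; 597; 329; 832; 749; 154; 890; 130; 235; 450; 1075; 1026; 497;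
     979; 782; 669; 71; 183; 1138; 264; 931; 567; 853; 50; 288; 698; 341; 740; 6];
  [:: 131; 317; 139; 687; 362; 64; 652; 498; 840; 913; 566; 375; 776; 242; 289; 719; 617; 1082; 412;
     953; 878; 12; 587; 188; 791; 236; 1110; 950; 90; 989; 1046; 1128; 467; 529];
  [:: 334; 612; 691; 982; 453; 390; 755; 590; 946; 745; 867; 1091; 9; 159; 1002; 437; 199; 49; 1151;
     1037; 256; 548; 1085; 496; 786; 275; 888; 108; 662; 821; 370; 209; 531; 101];
  [:: 622; 732; 539; 873; 56; 695; 313; 491; 1013; 206; 972; 114; 265; 813; 1057; 574; 144; 299;
     424; 579; 97; 365; 1052; 1097; 170; 932; 905; 827; 1125; 380; 771; 660; 24; 449];
  [:: 194; 714; 213; 331; 968; 576; 411; 133; 650; 937; 1067; 1034; 361; 992; 761; 610; 541; 1149;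
     477; 387; 903; 862; 808; 1118; 702; 829; 156; 619; 278; 85; 456; 241; 5; 67];
  [:: 533; 272; 869; 752; 690; 38; 372; 1065; 951; 798; 189; 2; 1109; 482; 104; 440; 991; 955; 466;
     915; 592; 250; 327; 1027; 736; 1139; 634; 226; 572; 167; 665; 86; 401; 820];
  [:: 1014; 1101; 87; 419; 231; 122; 25; 478; 831; 1061; 608; 809; 520; 975; 325; 1123; 938; 768;
     688; 252; 1039; 196; 469; 282; 136; 865; 348; 626; 565; 909; 383; 653; 743; 46];
  [:: 984; 737; 836; 751; 267; 794; 330; 217; 547; 1012; 925; 1072; 581; 148; 26; 295; 536; 646;
     1142; 398; 118; 507; 859; 694; 621; 357; 172; 912; 1112; 40; 1023; 475; 409; 92];
  [:: 871; 515; 822; 21; 1042; 721; 922; 692; 80; 488; 591; 218; 302; 766; 673; 431; 906; 964; 147;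
     255; 180; 807; 340; 461; 1069; 339; 391; 1140; 1093; 1007; 35; 645; 124; 577];
  [:: 838; 1122; 882; 1017; 105; 367; 484; 23; 1089; 200; 754; 718; 939; 1043; 245; 72; 441; 799;
     601; 333; 61; 395; 514; 233; 916; 138; 1068; 615; 712; 445; 276; 967; 575; 648];
  [:: 454; 942; 93; 1059; 681; 893; 151; 492; 32; 537; 269; 856; 556; 801; 314; 969; 774; 417; 651;
     1032; 1153; 628; 347; 63; 115; 1001; 386; 849; 296; 176; 584; 747; 1113; 204];
  [:: 465; 1102; 1080; 94; 639; 701; 580; 125; 1124; 767; 891; 738; 290; 524; 249; 664; 970; 864;
     947; 1016; 573; 1031; 355; 140; 493; 47; 434; 402; 220; 790; 18; 177; 818; 307];
  [:: 603; 446; 896; 42; 562; 1035; 935; 211; 655; 337; 408; 17; 739; 129; 846; 530; 79; 392; 811;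
     857; 965; 162; 506; 369; 1006; 748; 1144; 279; 682; 268; 173; 1095; 1077; 631];
  [:: 145; 270; 709; 518; 376; 994; 742; 677; 413; 473; 945; 585; 121; 560; 352; 11; 756; 632; 509;
     318; 1137; 875; 185; 274; 1120; 230; 1021; 966; 802; 892; 1062; 74; 65; 826];
  [:: 819; 980; 997; 187; 280; 1041; 876; 758; 158; 321; 123; 1154; 928; 654; 1079; 803; 48; 244;
     436; 451; 519; 223; 28; 1106; 84; 500; 568; 384; 886; 707; 589; 717; 371; 616];
  [:: 102; 37; 1074; 251; 689; 825; 527; 1094; 797; 1011; 775; 571; 614; 215; 389; 99; 731; 609;
     1051; 16; 672; 850; 956; 505; 433; 190; 286; 328; 464; 1135; 926; 356; 907; 150];
  [:: 847; 995; 596; 128; 1020; 343; 940; 883; 711; 257; 1148; 442; 422; 39; 904; 517; 141; 178; 15;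
     284; 1088; 1056; 95; 629; 399; 502; 663; 723; 974; 336; 773; 555; 227; 805];
  [:: 993; 31; 1076; 298; 1099; 208; 459; 841; 476; 326; 722; 656; 943; 760; 1147; 977; 1040; 684;
     243; 385; 636; 160; 881; 78; 911; 783; 418; 51; 201; 593; 127; 553; 516; 363];
  [:: 725; 404; 198; 472; 420; 647; 109; 277; 1126; 854; 625; 338; 759; 910; 815; 168; 1009; 538;
     708; 823; 238; 1087; 70; 551; 52; 918; 351; 207; 978; 586; 1024; 30; 501; 1117];
  [:: 1141; 607; 795; 920; 1004; 769; 379; 416; 225; 271; 1036; 880; 14; 119; 683; 181; 458; 77; 45;
     564; 641; 283; 670; 715; 346; 848; 335; 1054; 161; 899; 480; 543; 1116; 960];
  [:: 1131; 7; 179; 294; 166; 667; 540; 812; 89; 644; 239; 490; 229; 1104; 983; 781; 36; 316; 470;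
     710; 897; 414; 1022; 578; 817; 744; 1064; 851; 364; 106; 406; 923; 559; 1003];
  [:: 452; 1103; 734; 675; 142; 874; 1070; 1030; 793; 545; 713; 606; 319; 485; 1134; 222; 192; 266;
     532; 0; 113; 954; 635; 986; 900; 68; 358; 934; 429; 842; 66; 394; 291; 778];
  [:: 844; 764; 611; 486; 630; 182; 1092; 146; 889; 735; 863; 525; 976; 462; 285; 796; 1150; 1045;
     13; 374; 254; 311; 439; 1060; 658; 228; 921; 563; 60; 91; 1018; 373; 111; 680]]%num.

Lemma square_table34 : square_table 34 19635 15125495 table34.
Proof. by vm_compute. Qed.

Definition row_codes34 : seq nat :=
  nseq 17 0 ++
  [:: 5; 2; 0; 0; 5; 0; 3; 2; 4; 3; 0; 4; 5; 0; 5; 4; 4].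

Definition col_codes34 : seq nat :=
  [:: 5; 2; 3; 2; 0; 2; 4; 5; 3; 1; 4; 2; 2; 0; 4; 5; 2; 0; 4; 1; 3; 5; 4; 2; 4; 4; 1; 2; 5; 3; 0;
     4; 1; 3].

Lemma triple_codes34 : triple_codes 34 19635 table34 row_codes34 col_codes34.
Proof. by vm_compute. Qed.

Definition table38 : seq (seq N) := [::
  [:: 729; 640; 702; 36; 1397; 1162; 314; 760; 851; 1436; 1021; 682; 268; 931; 141; 831; 523; 534;
     207; 1288; 1077; 354; 428; 169; 380; 71; 1044; 1179; 461; 77; 1103; 607; 1239; 262; 974; 1333;
     1297; 909];
  [:: 298; 591; 516; 1258; 475; 396; 771; 744; 98; 1176; 434; 872; 968; 1300; 1347; 263; 145; 1121;
     647; 319; 375; 949; 609; 895; 685; 824; 1194; 1000; 53; 1072; 546; 163; 1244; 1386; 190; 1056;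
     1426; 11];
  [:: 191; 712; 1135; 665; 550; 1315; 63; 320; 15; 165; 844; 379; 1034; 1231; 505; 110; 981; 238;
     723; 1431; 1144; 1101; 1394; 929; 1190; 598; 1331; 281; 443; 802; 406; 480; 123; 900; 1280;
     635; 779; 994];
  [:: 310; 73; 1313; 583; 1080; 1339; 881; 641; 369; 1019; 415; 1423; 772; 520; 153; 272; 435; 736;
     491; 1271; 1154; 961; 805; 214; 122; 948; 836; 1393; 720; 91; 5; 547; 1054; 1126; 1237; 252;
     676; 1180];
  [:: 134; 1058; 340; 40; 459; 939; 1440; 1357; 1223; 201; 1; 884; 1088; 849; 409; 1141; 113; 1259;
     714; 508; 562; 1382; 775; 958; 1134; 1185; 431; 683; 590; 822; 1016; 1294; 367; 754; 170; 232;
     290; 615];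
  [:: 552; 1196; 30; 747; 510; 107; 297; 616; 432; 1276; 710; 1105; 858; 920; 667; 1356; 127; 393;
     1316; 341; 1043; 1167; 193; 1378; 260; 347; 52; 584; 1083; 1247; 1015; 812; 768; 978; 877;
     1427; 172; 458];
  [:: 515; 144; 725; 699; 867; 101; 796; 989; 593; 1308; 356; 1412; 399; 457; 819; 928; 888; 1401;
     1263; 652; 16; 553; 247; 1240; 1165; 160; 980; 448; 218; 1032; 1346; 1093; 61; 279; 627; 1192;
     1139; 309];
  [:: 841; 350; 381; 1215; 1024; 776; 967; 1116; 421; 296; 738; 1418; 99; 1094; 473; 14; 901; 1146;
     1384; 1265; 804; 62; 1358; 189; 1218; 689; 251; 313; 1328; 1041; 116; 545; 530; 666; 599; 630;
     225; 934];
  [:: 164; 1336; 26; 778; 76; 239; 1404; 658; 519; 54; 875; 1060; 1151; 1249; 130; 436; 619; 413;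
     488; 808; 987; 730; 1264; 1124; 216; 532; 856; 706; 1408; 945; 1064; 1003; 374; 300; 604; 1327;
     307; 1187];
  [:: 1120; 1183; 9; 157; 995; 600; 903; 1398; 820; 1354; 1279; 425; 219; 656; 975; 1095; 306; 376;
     751; 847; 1305; 146; 769; 1406; 925; 1147; 638; 691; 567; 254; 394; 271; 1052; 108; 502; 1243;
     42; 489];
  [:: 1367; 433; 248; 1387; 1430; 618; 1160; 798; 746; 1295; 568; 1005; 1269; 1086; 156; 224; 891;
     1057; 525; 417; 93; 721; 322; 953; 1178; 594; 651; 2; 865; 912; 477; 1113; 770; 365; 1253; 128;
     273; 67];
  [:: 586; 866; 835; 1307; 1082; 1388; 784; 142; 226; 496; 389; 977; 377; 1059; 1337; 474; 650; 438;
     1429; 95; 44; 3; 1270; 896; 182; 240; 1108; 1211; 624; 335; 278; 556; 1152; 988; 1234; 943;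
     688; 728];
  [:: 304; 1173; 1063; 716; 34; 791; 1221; 1411; 1314; 880; 1278; 361; 917; 408; 737; 646; 86; 538;
     963; 483; 437; 1078; 1213; 578; 1023; 1350; 803; 1383; 1118; 183; 637; 136; 513; 242; 46; 289;
     209; 855];
  [:: 1322; 678; 1189; 756; 973; 1274; 308; 1236; 923; 400; 765; 234; 587; 565; 357; 106; 620; 1071;
     814; 451; 1156; 992; 1402; 467; 147; 1425; 1033; 200; 701; 840; 301; 902; 162; 60; 12; 1129;
     1348; 511];
  [:: 18; 1434; 186; 261; 220; 333; 800; 78; 1317; 544; 362; 671; 1025; 504; 479; 848; 1039; 1174;
     121; 69; 644; 876; 430; 576; 1332; 276; 1227; 1107; 933; 1085; 403; 1391; 1214; 727; 1282; 962;
     703; 766];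
  [:: 674; 1376; 342; 283; 628; 1067; 49; 264; 745; 864; 1435; 573; 125; 1133; 1349; 211; 37; 827;
     444; 997; 1177; 1203; 543; 774; 318; 983; 472; 1027; 177; 879; 1226; 1301; 80; 416; 713; 915;
     503; 1287];
  [:: 1172; 698; 1117; 392; 346; 1368; 337; 1309; 1285; 13; 947; 229; 956; 181; 1066; 748; 1342; 72;
     540; 832; 518; 282; 115; 990; 904; 478; 102; 657; 1250; 1415; 212; 852; 623; 570; 1062; 446;
     1201; 790];
  [:: 1257; 1061; 506; 566; 818; 266; 327; 150; 35; 941; 204; 783; 1074; 1407; 1400; 158; 753; 1251;
     79; 440; 249; 360; 952; 649; 1296; 1102; 1170; 707; 1355; 462; 382; 601; 625; 1018; 846; 1212;
     887; 68];
  [:: 1137; 50; 787; 244; 178; 951; 539; 1087; 4; 287; 654; 1050; 1323; 1363; 1233; 109; 755; 349;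
     1428; 424; 1155; 487; 687; 1372; 221; 1206; 1002; 585; 611; 138; 883; 1275; 839; 813; 339; 919;
     412; 521];
  [:: 979; 569; 330; 991; 1238; 1048; 1319; 874; 426; 398; 1143; 174; 935; 695; 643; 842; 497; 821;
     1205; 217; 470; 1364; 137; 47; 792; 726; 22; 366; 257; 1385; 1266; 1070; 1439; 88; 1112; 284;
     660; 588];
  [:: 780; 1416; 932; 733; 395; 485; 629; 498; 816; 686; 1320; 241; 1395; 222; 324; 1222; 555; 1291;
     455; 1065; 83; 1029; 985; 132; 668; 159; 65; 1114; 1020; 908; 1191; 10; 606; 1330; 267; 854;
     1164; 372];
  [:: 1158; 59; 1341; 411; 292; 493; 188; 1232; 921; 1207; 441; 535; 632; 1007; 29; 1130; 1026; 897;
     124; 352; 1326; 761; 531; 845; 199; 663; 92; 328; 1289; 1076; 1422; 809; 580; 1399; 231; 960;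
     734; 697];
  [:: 972; 233; 633; 605; 1230; 1079; 910; 750; 1035; 514; 1413; 922; 152; 1344; 1312; 1210; 1009;
     794; 659; 810; 293; 370; 414; 133; 103; 718; 868; 1375; 1128; 466; 315; 420; 558; 192; 1150; 0;
     66; 1262];
  [:: 1306; 843; 1045; 1127; 1188; 494; 610; 986; 25; 680; 1140; 288; 210; 1373; 325; 1419; 882;
     1006; 57; 390; 126; 589; 944; 81; 348; 1246; 749; 1286; 447; 253; 456; 185; 1340; 834; 1097;
     559; 793; 690];
  [:: 299; 603; 833; 171; 722; 608; 886; 694; 1228; 1122; 195; 930; 486; 70; 1362; 1159; 1012; 112;
     1293; 837; 954; 500; 1055; 452; 388; 1281; 797; 135; 323; 7; 1084; 351; 230; 548; 1432; 679;
     1381; 1198];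
  [:: 823; 256; 636; 762; 285; 55; 1051; 131; 175; 492; 1091; 418; 1267; 404; 965; 926; 1248; 537;
     684; 1106; 33; 1304; 90; 571; 1008; 1169; 203; 1409; 653; 499; 890; 758; 1365; 326; 861; 373;
     1197; 1396];
  [:: 1351; 996; 269; 557; 982; 75; 228; 869; 889; 1031; 187; 197; 1389; 501; 1157; 828; 343; 87;
     1216; 1433; 592; 1115; 940; 460; 648; 1199; 642; 789; 148; 1310; 1075; 449; 715; 407; 19; 311;
     740; 1273];
  [:: 331; 1017; 602; 645; 1219; 892; 1186; 358; 709; 1329; 743; 56; 476; 140; 763; 405; 243; 1145;
     927; 871; 970; 194; 166; 1255; 1098; 1028; 1421; 1104; 1405; 291; 541; 6; 806; 509; 84; 675;
     454; 1353];
  [:: 859; 1109; 410; 938; 577; 104; 1252; 119; 1036; 677; 213; 1370; 731; 471; 1069; 969; 622; 179;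
     788; 1209; 704; 907; 295; 1010; 1325; 1366; 38; 250; 1410; 1153; 23; 445; 542; 495; 355; 1256;
     316; 825];
  [:: 387; 363; 1132; 1283; 149; 572; 94; 1040; 429; 631; 1345; 1011; 899; 777; 561; 529; 1441;
     1302; 1092; 739; 265; 717; 21; 655; 857; 196; 43; 329; 811; 1235; 1142; 942; 277; 1369; 957;
     167; 465; 1193];
  [:: 223; 180; 39; 1254; 661; 401; 450; 85; 1099; 312; 582; 1443; 464; 259; 353; 1229; 564; 20;
     807; 617; 959; 782; 700; 1138; 946; 1037; 870; 303; 526; 732; 1001; 1181; 1321; 1377; 878;
     1343; 1163; 118];
  [:: 773; 860; 1437; 237; 1260; 741; 151; 830; 1090; 275; 168; 482; 1149; 32; 914; 681; 950; 1038;
     317; 612; 1119; 51; 894; 215; 1014; 384; 1360; 719; 345; 453; 581; 1208; 517; 1379; 1324; 89;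
     551; 1217];
  [:: 1414; 1204; 913; 74; 120; 1100; 898; 173; 386; 1390; 863; 1268; 442; 522; 368; 1303; 245; 198;
     1049; 1359; 724; 692; 1224; 955; 1131; 672; 815; 336; 468; 621; 1168; 1022; 27; 554; 764; 294;
     579; 82];
  [:: 1110; 670; 767; 528; 916; 1241; 1277; 28; 1311; 560; 595; 801; 255; 305; 850; 427; 184; 1013;
     114; 1047; 1424; 286; 1403; 742; 385; 378; 1195; 1073; 964; 639; 208; 96; 469; 911; 705; 1161;
     1334; 45];
  [:: 176; 795; 1420; 1030; 549; 998; 129; 757; 1292; 235; 1392; 693; 669; 423; 1125; 1261; 1361;
     873; 829; 100; 1081; 41; 463; 1184; 574; 397; 626; 338; 17; 918; 1242; 227; 344; 984; 512; 302;
     1175; 885];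
  [:: 364; 527; 993; 1438; 1202; 97; 1166; 1096; 662; 481; 24; 117; 64; 786; 906; 838; 1298; 759;
     976; 1371; 826; 1338; 1111; 280; 383; 161; 597; 332; 1046; 246; 202; 708; 1220; 439; 924; 613;
     1290; 536];
  [:: 484; 634; 1053; 1225; 154; 999; 936; 781; 1200; 575; 673; 143; 48; 1068; 422; 799; 1442; 893;
     8; 205; 524; 1374; 735; 1299; 274; 111; 971; 1272; 334; 258; 711; 1171; 1123; 1352; 391; 563;
     359; 853];
  [:: 937; 31; 1182; 1318; 1136; 905; 696; 1042; 752; 817; 614; 785; 1245; 105; 236; 270; 1284; 58;
     490; 139; 1004; 596; 533; 206; 1380; 371; 862; 402; 321; 1335; 1089; 1417; 1148; 966; 507; 664;
     419; 155]]%num.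

Lemma square_table38 : square_table 38 27417 26384293 table38.
Proof. by vm_compute. Qed.

Definition row_codes38 : seq nat :=
  nseq 19 0 ++
  [:: 3; 4; 3; 2; 3; 4; 5; 3; 4; 1; 2; 2; 5; 5; 5; 0; 5; 5; 3].

Definition col_codes38 : seq nat :=
  [:: 4; 2; 3; 2; 0; 3; 2; 2; 3; 2; 1; 4; 5; 2; 5; 0; 0; 4; 5; 5; 3; 4; 4; 4; 2; 2; 5; 3; 0; 4; 4;
     5; 0; 3; 4; 4; 4; 2].

Lemma triple_codes38 : triple_codes 38 27417 table38 row_codes38 col_codes38.
Proof. by vm_compute. Qed.

(** Order 42 has no table, being the triple of 14. *)
Definition table46 : seq (seq N) := [::
  [:: 974; 308; 1492; 901; 628; 1858; 479; 1053; 1554; 447; 1440; 1365; 694; 1297; 209; 1795; 674;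
     171; 239; 1163; 527; 843; 2050; 1594; 122; 1743; 335; 1675; 1198; 1281; 412; 1149; 1088; 1970;
     1921; 65; 2014; 930; 2071; 571; 1403; 1; 1750; 813; 752; 1626];
  [:: 167; 1443; 650; 710; 955; 910; 1339; 998; 579; 134; 62; 1566; 1920; 257; 2058; 1985; 1667;
     1504; 467; 192; 318; 1623; 1393; 1287; 372; 1873; 446; 1085; 38; 839; 625; 1731; 1761; 1018;
     1218; 362; 1818; 1963; 2115; 1324; 1545; 801; 738; 1161; 1111; 517];
  [:: 59; 252; 1480; 1132; 1009; 1099; 1791; 682; 723; 1643; 641; 1310; 140; 850; 493; 1335; 736;
     1430; 1177; 1266; 443; 518; 284; 1207; 2040; 107; 1904; 366; 1987; 896; 1556; 1958; 560; 1669;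
     1412; 1576; 189; 1717; 407; 2082; 799; 1870; 944; 1827; 25; 1054];
  [:: 502; 1174; 1721; 1477; 1665; 996; 945; 2102; 423; 1968; 676; 348; 785; 1918; 1841; 875; 1418;
     1286; 865; 1434; 320; 1789; 769; 2013; 94; 396; 151; 596; 1645; 1794; 80; 1239; 1139; 731;
     1343; 601; 13; 1313; 2035; 1066; 203; 233; 1526; 1028; 531; 1578];
  [:: 2026; 702; 804; 471; 129; 1068; 1690; 988; 1783; 410; 165; 1109; 10; 2012; 1544; 459; 2111;
     1931; 69; 332; 1452; 1621; 588; 1808; 541; 1352; 1235; 1274; 1153; 1381; 315; 1964; 1607; 739;
     890; 954; 267; 1014; 829; 1484; 1878; 1292; 1712; 222; 611; 649];
  [:: 1182; 207; 463; 802; 1247; 1473; 1902; 47; 1881; 1697; 984; 781; 546; 2080; 1792; 1530; 934;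
     1606; 1619; 24; 1386; 701; 411; 1205; 363; 1057; 1446; 1065; 1134; 594; 880; 1345; 282; 598;
     153; 1943; 137; 271; 1836; 1995; 1309; 441; 655; 2066; 1728; 847];
  [:: 1884; 1590; 1283; 979; 498; 1910; 2074; 450; 1144; 1445; 554; 40; 2060; 1416; 1336; 889; 214;
     364; 522; 1961; 1689; 1023; 1165; 1757; 679; 774; 276; 1639; 920; 1293; 1988; 714; 616; 389;
     116; 860; 1232; 56; 1705; 261; 782; 1502; 1561; 1814; 1075; 146];
  [:: 777; 1011; 624; 2007; 353; 1289; 499; 383; 1892; 421; 1774; 136; 919; 581; 2024; 707; 255;
     283; 1470; 1945; 784; 653; 1282; 1037; 1171; 1401; 1535; 1686; 1098; 1567; 1834; 66; 2110;
     1206; 1610; 1742; 173; 513; 1105; 8; 1334; 873; 923; 200; 1868; 1516];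
  [:: 1224; 879; 1707; 780; 828; 336; 544; 678; 1186; 170; 2092; 927; 385; 1797; 721; 476; 1027;
     1909; 2068; 1764; 1497; 1376; 1318; 36; 126; 1559; 1592; 287; 204; 432; 1957; 251; 1062; 1453;
     600; 1994; 803; 583; 1387; 1661; 73; 1145; 1650; 1876; 1259; 966];
  [:: 539; 578; 891; 243; 1741; 838; 1889; 228; 1993; 1793; 20; 926; 1508; 1323; 1636; 53; 1688;
     1948; 1798; 1865; 1275; 826; 1351; 325; 1528; 2084; 2046; 693; 455; 1050; 1449; 475; 376; 163;
     317; 685; 1133; 1204; 1414; 127; 1159; 1609; 740; 1078; 607; 978];
  [:: 3; 1630; 1010; 907; 1042; 965; 1091; 868; 737; 1952; 1767; 190; 708; 1854; 1120; 1265; 1435;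
     161; 1405; 643; 1596; 2079; 569; 1700; 415; 293; 1192; 1563; 654; 1709; 2016; 795; 347; 1515;
     132; 81; 1799; 1891; 1340; 535; 485; 2025; 379; 234; 1231; 1317];
  [:: 1986; 681; 1490; 178; 547; 470; 64; 627; 597; 796; 1555; 1602; 1026; 1856; 837; 712; 1308;
     240; 1119; 409; 760; 1212; 1771; 1820; 430; 324; 1722; 876; 1637; 312; 935; 1432; 1930; 27;
     1363; 1691; 1059; 92; 1278; 1173; 2054; 1933; 210; 1006; 1410; 2088];
  [:: 503; 827; 1214; 89; 1302; 154; 458; 1973; 1598; 1848; 757; 909; 1061; 1385; 987; 1710; 1692;
     1183; 1350; 1635; 1899; 1506; 341; 675; 386; 1782; 277; 1245; 835; 1546; 2105; 515; 2051; 31;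
     552; 1113; 610; 697; 947; 272; 1984; 1460; 1032; 100; 1829; 220];
  [:: 767; 1861; 1438; 1150; 577; 1638; 1522; 1347; 1953; 1664; 949; 2020; 302; 726; 141; 473; 1236;
     1107; 384; 88; 1768; 800; 2047; 1019; 1815; 274; 216; 1512; 672; 2093; 1419; 1284; 870; 326;
     1901; 1300; 636; 904; 1582; 549; 15; 97; 1058; 969; 431; 1745];
  [:: 1853; 1565; 733; 1784; 1326; 32; 1086; 408; 500; 1252; 894; 156; 1408; 537; 250; 2065; 334;
     1209; 2100; 1954; 1704; 1824; 2011; 748; 1172; 968; 666; 316; 845; 1367; 958; 196; 1622; 1676;
     1020; 1104; 445; 1499; 629; 1925; 1429; 104; 46; 811; 1525; 589];
  [:: 576; 1999; 418; 964; 1975; 1572; 1489; 125; 673; 1433; 1374; 370; 263; 143; 1141; 307; 1776;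
     342; 1311; 1170; 1520; 188; 825; 2096; 1678; 2045; 888; 1398; 1714; 1076; 482; 633; 1211; 1038;
     1811; 74; 862; 23; 1879; 520; 1641; 1256; 779; 698; 1888; 1001];
  [:: 1969; 1426; 2112; 1227; 41; 859; 1115; 669; 511; 741; 374; 1699; 1927; 1533; 1632; 717; 1044;
     1483; 266; 491; 1859; 1271; 883; 788; 971; 1754; 300; 54; 1389; 2003; 449; 613; 99; 1181; 568;
     953; 1081; 1800; 1574; 354; 1730; 215; 1368; 1330; 183; 2039];
  [:: 2038; 439; 1411; 1279; 1151; 280; 1813; 887; 1763; 1234; 506; 1471; 1981; 793; 1305; 1966; 96;
     960; 9; 2087; 212; 1735; 1864; 734; 770; 371; 989; 1378; 1895; 1070; 496; 1679; 555; 1495; 164;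
     867; 61; 1600; 273; 683; 1614; 346; 1117; 634; 1056; 1518];
  [:: 1118; 640; 1442; 1996; 2107; 893; 1633; 1509; 973; 237; 1040; 1801; 1072; 298; 817; 1585; 861;
     365; 1695; 1400; 1852; 428; 1936; 375; 951; 557; 1550; 4; 123; 749; 1250; 1713; 504; 1329;
     1156; 2069; 538; 1366; 1928; 725; 1755; 652; 159; 217; 1199; 78];
  [:: 856; 1990; 807; 645; 1320; 55; 1734; 1226; 961; 771; 1906; 730; 1821; 1422; 147; 1486; 1130;
     1751; 1541; 1655; 536; 1444; 1048; 258; 1950; 429; 120; 392; 1860; 1188; 1579; 1243; 892; 460;
     44; 994; 582; 1084; 2076; 1694; 2032; 630; 1357; 327; 187; 285];
  [:: 381; 254; 1356; 1843; 419; 1423; 1627; 704; 223; 49; 319; 1668; 1584; 1826; 635; 972; 1922;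
     355; 1164; 1939; 474; 1997; 17; 110; 1223; 1249; 866; 1306; 2081; 2061; 1055; 940; 158; 797;
     523; 755; 1464; 1726; 1092; 1474; 1788; 1129; 680; 585; 885; 1547];
  [:: 605; 406; 1680; 1603; 794; 262; 667; 1959; 705; 68; 1838; 2089; 1531; 1217; 836; 564; 1138;
     1301; 6; 981; 759; 1718; 135; 1095; 1158; 329; 1377; 157; 1424; 1612; 1857; 916; 929; 1908;
     483; 1513; 1025; 1268; 521; 211; 426; 1766; 321; 1992; 1467; 2028];
  [:: 982; 1787; 1851; 1332; 805; 1196; 548; 1450; 1553; 617; 225; 1744; 939; 882; 1683; 857; 1616;
     133; 561; 244; 2042; 1260; 83; 727; 747; 436; 343; 1905; 1388; 155; 1481; 7; 2004; 1595; 1806;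
     1022; 304; 1977; 1193; 1360; 1108; 390; 2098; 651; 495; 1063];
  [:: 1080; 1521; 306; 119; 394; 772; 1125; 1624; 434; 664; 1866; 359; 2072; 830; 618; 1407; 1786;
     510; 798; 1711; 1967; 911; 1564; 168; 1375; 713; 224; 16; 1024; 1701; 2019; 1280; 1468; 1924;
     1503; 1200; 2037; 1187; 464; 941; 1314; 553; 1796; 970; 260; 70];
  [:: 746; 417; 2108; 361; 991; 1476; 501; 305; 1867; 1402; 1756; 606; 1237; 1657; 1802; 34; 1162;
     1618; 1029; 586; 677; 1448; 833; 1333; 1599; 514; 915; 202; 52; 1956; 1146; 1539; 715; 2052;
     1276; 413; 963; 2023; 160; 95; 1348; 1894; 786; 1706; 245; 1094];
  [:: 288; 1677; 124; 2000; 1855; 1169; 684; 742; 1361; 1039; 1500; 942; 1148; 1384; 1519; 1295;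
     729; 823; 1466; 451; 399; 556; 1093; 5; 545; 1647; 918; 1809; 1762; 1270; 494; 352; 1942; 58;
     193; 1233; 623; 235; 1580; 1929; 967; 139; 1725; 2086; 2036; 853];
  [:: 1395; 1597; 1562; 1043; 1344; 2083; 1937; 1628; 1216; 1137; 1294; 1008; 351; 1454; 1760; 903;
     626; 659; 507; 841; 735; 1103; 291; 414; 593; 63; 373; 191; 174; 1724; 487; 753; 121; 1816;
     1989; 22; 1917; 1673; 952; 238; 1863; 791; 2033; 1510; 1285; 1189];
  [:: 1634; 528; 878; 387; 2057; 921; 1573; 980; 221; 2109; 1296; 249; 1228; 1475; 1168; 1919; 1082;
     595; 1779; 1542; 1451; 77; 1716; 340; 468; 776; 637; 1338; 1244; 176; 1425; 1030; 1946; 278;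
     644; 424; 1684; 1147; 852; 2010; 39; 131; 696; 1849; 809; 1837];
  [:: 11; 570; 505; 186; 1230; 1005; 751; 1907; 172; 1251; 232; 1307; 1359; 931; 1830; 1842; 2085;
     1625; 1659; 1135; 642; 108; 1016; 532; 1461; 1178; 1998; 874; 2048; 872; 1514; 290; 349; 806;
     1747; 718; 1748; 1971; 435; 668; 395; 1060; 1569; 84; 1421; 1548];
  [:: 792; 1517; 453; 691; 486; 1155; 268; 881; 1979; 1649; 1965; 42; 1382; 1102; 199; 1201; 844;
     1431; 1015; 142; 983; 591; 1349; 1586; 1540; 1790; 50; 1142; 130; 542; 599; 1839; 1887; 1261;
     761; 1874; 2099; 1738; 1319; 338; 303; 2034; 959; 687; 380; 1670];
  [:: 975; 744; 2113; 1736; 1765; 1127; 724; 19; 906; 259; 1457; 1660; 1577; 492; 1558; 2063; 391;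
     286; 1087; 1611; 2015; 180; 433; 612; 1379; 1406; 1033; 1847; 948; 1485; 90; 213; 1263; 663;
     1288; 869; 1213; 117; 512; 783; 322; 1195; 1934; 1831; 1897; 567];
  [:: 1021; 1116; 1321; 275; 2031; 1654; 525; 1373; 297; 1850; 572; 711; 1262; 111; 145; 1810; 405;
     897; 1390; 1179; 928; 2; 440; 1727; 1752; 1459; 1674; 1593; 1551; 75; 686; 1912; 639; 1197;
     810; 462; 1067; 1496; 330; 2091; 997; 2018; 1962; 831; 226; 775];
  [:: 1932; 758; 1775; 1715; 1371; 2103; 311; 526; 466; 670; 1846; 1225; 602; 444; 1415; 208; 1822;
     1494; 113; 898; 1642; 720; 2021; 1097; 71; 1575; 1167; 377; 986; 236; 1896; 2055; 1524; 337;
     1034; 790; 1682; 1112; 1469; 1277; 858; 1290; 946; 179; 35; 575];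
  [:: 1482; 185; 1114; 1719; 279; 18; 848; 1041; 357; 933; 489; 1885; 1220; 1980; 1773; 660; 403;
     1069; 550; 425; 1974; 2059; 706; 1242; 590; 1825; 900; 1342; 1316; 91; 622; 1160; 2114; 175;
     114; 812; 1604; 763; 1617; 1391; 1681; 1890; 247; 1428; 992; 1560];
  [:: 206; 1911; 452; 2056; 1202; 378; 2078; 309; 1687; 1978; 912; 1004; 109; 333; 1370; 1536; 51;
     638; 1648; 1013; 1083; 1383; 709; 477; 688; 563; 1770; 1498; 1940; 242; 765; 1589; 957; 855;
     1267; 1124; 1176; 1723; 30; 1862; 789; 1327; 1456; 516; 1823; 162];
  [:: 631; 169; 565; 815; 1238; 2097; 48; 2009; 388; 1071; 358; 2041; 1273; 1840; 219; 253; 1355;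
     1746; 851; 1291; 296; 480; 1976; 1629; 1568; 1832; 1396; 37; 442; 1052; 1543; 1923; 773; 932;
     1472; 93; 509; 1463; 662; 722; 1749; 1136; 1154; 985; 905; 1658];
  [:: 863; 562; 256; 1663; 33; 1437; 1571; 1720; 914; 1804; 2022; 1505; 999; 1246; 1362; 345; 508;
     2062; 1203; 1651; 1184; 1110; 1944; 1926; 1303; 313; 1399; 1877; 1017; 85; 138; 115; 1090; 472;
     1758; 822; 398; 661; 754; 1557; 422; 716; 962; 603; 2075; 218];
  [:: 1222; 57; 144; 950; 393; 750; 695; 1354; 533; 1007; 818; 1479; 1140; 465; 902; 1194; 615; 331;
     1458; 1587; 1101; 1875; 580; 265; 840; 1532; 1739; 1807; 1753; 1035; 197; 1916; 656; 2043;
     2002; 1640; 1656; 1253; 310; 1394; 1312; 456; 29; 1938; 2104; 118];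
  [:: 2027; 461; 1845; 743; 1913; 2090; 301; 1955; 1123; 1581; 1491; 82; 632; 181; 420; 1073; 0;
     1729; 1427; 227; 543; 1221; 658; 925; 2008; 1191; 1549; 1644; 587; 787; 1780; 128; 339; 908;
     1380; 1698; 1364; 264; 369; 849; 995; 1258; 1835; 1325; 1047; 692];
  [:: 1180; 2070; 778; 990; 819; 1759; 648; 1941; 1341; 1219; 917; 566; 281; 1620; 732; 1089; 367;
     177; 1588; 1269; 26; 1331; 1900; 1439; 1511; 478; 1805; 1882; 67; 402; 608; 1534; 1128; 937;
     205; 2067; 438; 534; 1732; 1397; 98; 2005; 230; 832; 1696; 1012];
  [:: 1190; 1817; 2101; 728; 401; 524; 60; 1935; 821; 490; 1685; 956; 1404; 328; 299; 201; 2006;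
     895; 103; 647; 248; 1844; 584; 1615; 1122; 448; 1785; 1045; 28; 1315; 620; 1702; 1215; 2064;
     1507; 1337; 1538; 1074; 148; 1605; 1003; 1255; 1898; 1436; 854; 764];
  [:: 2017; 1210; 427; 101; 1488; 241; 1131; 1672; 1880; 404; 703; 344; 184; 559; 2030; 45; 1960;
     2094; 1778; 289; 604; 820; 1064; 938; 79; 1893; 1631; 842; 1392; 551; 1264; 877; 1708; 1175;
     1601; 1552; 497; 993; 1031; 756; 1328; 1372; 182; 1455; 671; 1812];
  [:: 1465; 1991; 21; 2049; 1737; 1049; 976; 768; 72; 457; 314; 1693; 323; 558; 846; 1869; 690;
     1166; 198; 816; 481; 540; 1537; 1947; 1583; 1803; 1322; 619; 1106; 270; 913; 1413; 1241; 1346;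
     936; 2095; 1777; 105; 1096; 646; 382; 1254; 1493; 166; 1903; 1613];
  [:: 368; 1257; 1051; 1769; 977; 1646; 1883; 899; 766; 1703; 1523; 1409; 194; 149; 14; 1462; 1915;
     1828; 1671; 246; 1983; 106; 530; 573; 1972; 719; 943; 1079; 1229; 2044; 824; 614; 1157; 1304;
     657; 87; 1143; 484; 864; 1591; 454; 1478; 360; 1353; 294; 2073];
  [:: 1662; 1420; 150; 1653; 2106; 86; 356; 1501; 2053; 416; 1248; 834; 2001; 231; 814; 529; 922;
     1358; 1772; 1077; 574; 1733; 689; 1570; 1914; 884; 112; 1872; 400; 1000; 229; 745; 488; 699;
     1447; 1949; 1527; 1036; 43; 1299; 1185; 621; 292; 1819; 1208; 1121];
  [:: 1487; 1441; 519; 397; 76; 1529; 1652; 195; 1886; 762; 469; 1781; 2077; 1272; 665; 924; 609;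
     592; 350; 1369; 437; 12; 871; 1871; 1982; 886; 1833; 1240; 1100; 1666; 1608; 808; 152; 2029;
     1951; 1046; 1740; 102; 700; 1152; 295; 1002; 1298; 1417; 1126; 269]]%num.

Lemma square_table46 : square_table 46 48645 68605665 table46.
Proof. by vm_compute. Qed.

Definition row_codes46 : seq nat :=
  nseq 23 0 ++
  [:: 4; 5; 5; 0; 3; 5; 3; 4; 5; 1; 0; 3; 3; 1; 0; 2; 0; 0; 3; 5; 5; 0; 5].

Definition col_codes46 : seq nat :=
  [:: 0; 5; 4; 1; 1; 5; 3; 0; 1; 0; 2; 1; 1; 1; 0; 1; 0; 4; 2; 1; 5; 0; 0; 0; 5; 5; 5; 2; 5; 5; 5;
     5; 5; 3; 1; 4; 3; 1; 0; 4; 2; 3; 0; 5; 3; 5].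

Lemma triple_codes46 : triple_codes 46 48645 table46 row_codes46 col_codes46.
Proof. by vm_compute. Qed.

(** Orders 50 and 54 have no tables: they arise as 10 times 5 and as the triple of 18. *)
Definition table58 : seq (seq N) := [::
  [:: 2127; 2291; 1070; 286; 1011; 1903; 890; 3032; 1485; 2072; 807; 2359; 2408; 2449; 2620; 722;
     1814; 617; 3214; 93; 192; 1993; 551; 971; 1297; 1788; 3362; 1135; 838; 1592; 2216; 1176; 55;
     649; 1351; 1691; 1655; 2732; 1936; 373; 2695; 2892; 1239; 3298; 2915; 2994; 1552; 2839; 426;
     1406; 155; 476; 2563; 2163; 3105; 305; 3159; 2522];
  [:: 777; 2293; 1223; 281; 1413; 1503; 2553; 742; 1389; 531; 3253; 3008; 2654; 586; 1737; 80; 176;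
     3085; 2042; 3332; 2711; 461; 2515; 470; 27; 977; 2475; 2831; 1279; 2917; 1522; 1202; 396; 318;
     3216; 1601; 812; 3053; 2410; 2105; 168; 1967; 1802; 2737; 3137; 989; 2248; 1104; 2017; 2893;
     665; 915; 2179; 1900; 1781; 2354; 1073; 1642];
  [:: 1976; 418; 2261; 876; 2715; 3099; 1756; 3013; 3257; 2266; 2860; 795; 256; 962; 2513; 2907;
     1562; 1902; 1076; 1310; 2377; 1949; 1376; 2810; 1113; 2074; 14; 63; 351; 1429; 223; 1257; 2126;
     1501; 1575; 3218; 2413; 1810; 527; 2629; 1702; 1038; 501; 3356; 2447; 3041; 2156; 3138; 1635;
     832; 2774; 686; 170; 746; 2582; 611; 1184; 313];
  [:: 1652; 765; 2757; 3129; 523; 1809; 2949; 1622; 1031; 2263; 267; 1959; 3063; 368; 321; 1335;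
     2982; 49; 1246; 172; 2454; 2059; 911; 3196; 743; 198; 1985; 2501; 2106; 2792; 1856; 843; 1490;
     1757; 974; 2718; 1718; 2383; 1553; 88; 1314; 1405; 2619; 646; 2599; 2201; 1179; 3156; 2249;
     1132; 594; 491; 3348; 3252; 2888; 412; 1079; 2376];
  [:: 3255; 2617; 1083; 1172; 1657; 2306; 2396; 1540; 1409; 119; 752; 2340; 303; 229; 277; 2545;
     2193; 2684; 2918; 1341; 2117; 2595; 2027; 3066; 2841; 945; 1706; 539; 643; 3203; 1789; 59; 41;
     1032; 2488; 1502; 912; 1946; 3333; 2252; 2967; 1220; 505; 1878; 790; 626; 424; 2844; 2030; 830;
     1799; 1286; 380; 2773; 3087; 1599; 1138; 3179];
  [:: 553; 1867; 2211; 1468; 3170; 2886; 1563; 1006; 44; 1347; 2341; 3021; 1270; 219; 1627; 2319;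
     2191; 2079; 920; 2948; 2144; 3338; 3201; 149; 1928; 2826; 816; 1572; 1392; 705; 260; 1145; 331;
     1692; 949; 1824; 1208; 2504; 2717; 2382; 2999; 1740; 2487; 1319; 364; 779; 2614; 2770; 3276;
     1986; 462; 613; 485; 3122; 674; 78; 2565; 1061];
  [:: 2761; 2215; 3210; 2663; 2997; 1580; 70; 3043; 2856; 2399; 1674; 689; 955; 1915; 579; 637;
     2538; 1068; 1459; 2295; 236; 2347; 882; 3339; 3082; 2044; 2924; 148; 2827; 1889; 2609; 3283;
     1834; 3149; 1978; 1435; 1232; 1373; 785; 213; 2696; 2109; 1791; 2453; 719; 823; 290; 1291; 511;
     36; 1158; 407; 1005; 392; 2186; 1206; 1509; 1733];
  [:: 1739; 740; 2050; 2601; 1546; 3097; 142; 306; 3237; 2187; 2012; 1039; 1882; 3023; 361; 2099;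
     3187; 2316; 2626; 695; 1175; 1650; 1968; 1320; 1397; 248; 3271; 3310; 64; 1272; 493; 2986;
     2398; 2517; 975; 1125; 1466; 2343; 2897; 2674; 2735; 1829; 1573; 762; 2246; 601; 441; 1371;
     220; 1094; 906; 1743; 2790; 2909; 2493; 544; 821; 15];
  [:: 1707; 333; 541; 2991; 582; 2362; 137; 2456; 1907; 1433; 1296; 222; 1152; 3174; 1089; 2821;
     1350; 3240; 1258; 1662; 2716; 91; 2245; 254; 3299; 2746; 822; 944; 2625; 1606; 1762; 1007; 687;
     2503; 484; 3027; 2113; 463; 1835; 2267; 3089; 1210; 2904; 2203; 1998; 1470; 1923; 365; 6; 2055;
     3311; 1550; 889; 723; 766; 2574; 2419; 2863];
  [:: 3220; 447; 1151; 1644; 848; 2069; 1840; 2789; 1443; 1092; 2691; 3017; 1990; 1943; 1364; 2523;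
     2338; 3349; 1181; 1773; 940; 1904; 3294; 1510; 2993; 2647; 627; 3130; 29; 1283; 120; 2308; 383;
     1252; 2208; 1600; 315; 98; 549; 2392; 895; 2851; 2955; 677; 477; 2581; 800; 2477; 994; 2726;
     3185; 1703; 1476; 2096; 225; 2150; 252; 713];
  [:: 1402; 481; 2111; 121; 535; 1001; 1942; 1478; 1578; 2233; 1359; 1193; 1633; 904; 1249; 814;
     793; 1536; 2934; 2589; 445; 3009; 2760; 3345; 2624; 2365; 1289; 231; 2450; 3164; 930; 1782;
     1842; 284; 3290; 50; 2034; 2672; 1716; 676; 399; 302; 3052; 1122; 2889; 2281; 3131; 2008; 2793;
     2536; 732; 2170; 614; 1055; 3193; 2415; 114; 1877];
  [:: 2368; 1471; 525; 682; 2921; 2862; 1725; 634; 1571; 1818; 2093; 1780; 2039; 1294; 185; 324;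
     1107; 969; 2199; 42; 2699; 1668; 2231; 474; 1906; 131; 887; 2506; 1407; 3059; 1178; 460; 379;
     2996; 2588; 3158; 847; 1926; 2816; 2743; 1541; 1379; 721; 1100; 1221; 2279; 2404; 2660; 1987;
     784; 3236; 2440; 113; 1035; 3343; 3101; 3274; 241];
  [:: 914; 191; 2465; 2985; 2123; 3352; 2222; 85; 1848; 250; 1666; 2432; 1058; 518; 2733; 1908;
     1759; 385; 1494; 1164; 2634; 1153; 1042; 3055; 1307; 34; 1918; 1570; 2549; 597; 533; 2819;
     1346; 707; 145; 808; 2168; 928; 459; 2894; 2269; 2322; 1442; 644; 322; 2047; 1511; 2690; 3075;
     1734; 824; 3197; 1266; 2577; 3145; 2933; 2007; 3304];
  [:: 2923; 335; 1914; 1758; 2173; 1648; 1456; 1991; 3119; 899; 2478; 2364; 2253; 2578; 2384; 2896;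
     2062; 1523; 2524; 1160; 115; 1016; 139; 1144; 2762; 3004; 1290; 1612; 585; 1872; 858; 3269;
     2277; 1090; 3238; 402; 2817; 1261; 2680; 661; 3073; 193; 748; 961; 2101; 569; 3146; 776; 7;
     269; 3329; 409; 1425; 504; 1688; 2631; 1370; 1798];
  [:: 3005; 2772; 2685; 1267; 1281; 107; 2430; 3124; 23; 1715; 1939; 773; 304; 702; 1097; 960; 3270;
     389; 3173; 1744; 1028; 685; 2041; 1117; 495; 2852; 3031; 526; 1838; 233; 1566; 2115; 2902;
     1554; 169; 3306; 2603; 600; 2623; 1411; 1491; 2194; 1988; 1641; 1887; 2808; 3225; 2521; 839;
     444; 1383; 1205; 2369; 2314; 913; 175; 2461; 2214];
  [:: 651; 1983; 2557; 590; 1811; 1227; 428; 465; 2288; 387; 3019; 2418; 1515; 1325; 577; 1749; 132;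
     2853; 2632; 24; 3139; 1463; 2145; 2541; 805; 2258; 3091; 1911; 2944; 3282; 342; 1630; 2165;
     2777; 749; 212; 840; 1034; 276; 1110; 898; 81; 3320; 1361; 2980; 1163; 3232; 943; 2829; 1951;
     1081; 1574; 2719; 1720; 2068; 1420; 2468; 2374];
  [:: 1403; 2311; 1218; 3110; 919; 788; 2442; 1675; 1528; 1837; 2721; 1002; 2083; 1171; 1506; 1621;
     948; 2855; 502; 1046; 2182; 1940; 2133; 108; 275; 316; 3011; 2583; 2813; 366; 408; 2223; 178;
     2610; 152; 2425; 1293; 2342; 2528; 2937; 1769; 591; 3308; 1893; 1108; 869; 1713; 672; 753;
     3135; 3249; 2016; 1356; 2771; 3231; 33; 522; 3029];
  [:: 2666; 3314; 509; 2240; 2873; 957; 997; 448; 791; 1862; 679; 2668; 2015; 3258; 2731; 2476;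
     2334; 1426; 1565; 2313; 1381; 274; 61; 2073; 128; 711; 1191; 1712; 2573; 3153; 1247; 2950;
     3241; 2395; 1278; 1618; 2981; 312; 381; 2520; 555; 1078; 8; 1128; 1790; 2195; 2787; 2122; 1664;
     1822; 605; 3064; 819; 1941; 871; 1477; 218; 3081];
  [:: 2444; 242; 2927; 2178; 918; 1248; 815; 1067; 2283; 3061; 2828; 1111; 1018; 1577; 2239; 545;
     691; 2496; 1864; 3078; 2107; 2329; 2608; 1704; 2621; 2992; 74; 1980; 1358; 2879; 2686; 429;
     1952; 161; 397; 1767; 3293; 1497; 981; 768; 1440; 1185; 3188; 471; 1850; 3230; 2729; 710; 211;
     56; 603; 1679; 2414; 2058; 1323; 3319; 291; 1557];
  [:: 271; 1161; 2648; 3044; 21; 995; 2217; 2998; 2957; 3254; 1052; 2169; 390; 1256; 2714; 2834;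
     2861; 736; 1932; 1449; 1103; 862; 1763; 490; 2462; 574; 1560; 1680; 3204; 2046; 2379; 3144;
     1295; 3337; 181; 1831; 874; 2344; 1727; 2502; 71; 2286; 2141; 780; 1611; 680; 1461; 311; 158;
     2740; 980; 413; 1901; 1339; 625; 3125; 2570; 2018];
  [:: 2119; 1329; 2590; 934; 1345; 1493; 3169; 283; 2405; 1059; 174; 1935; 1545; 2910; 173; 1588;
     851; 2491; 3221; 888; 2864; 3016; 2146; 2280; 398; 416; 3096; 2209; 1275; 469; 1723; 1894;
     1805; 546; 1770; 3014; 2367; 3353; 66; 2795; 624; 1165; 1428; 688; 2063; 1634; 2748; 798; 1043;
     3303; 2494; 2659; 1977; 733; 296; 1121; 43; 2706];
  [:: 2084; 2554; 3207; 1804; 475; 2351; 1408; 2001; 1717; 1298; 703; 166; 2728; 557; 1673; 1965;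
     1216; 1242; 384; 1516; 2890; 259; 3160; 1156; 2835; 873; 2546; 325; 1784; 100; 996; 3020; 789;
     2234; 2135; 1085; 937; 206; 2670; 3012; 1488; 2479; 2938; 2315; 436; 593; 2148; 1585; 845;
     3117; 2616; 1367; 3251; 3355; 642; 2385; 1876; 30];
  [:: 1957; 2727; 2052; 2270; 1797; 1561; 2021; 363; 2687; 2228; 866; 954; 2954; 1841; 289; 745; 84;
     1458; 2095; 2984; 1037; 3336; 35; 3030; 2435; 1054; 1243; 3084; 299; 3152; 562; 2798; 640;
     1112; 1868; 2183; 1303; 451; 592; 2489; 2529; 810; 1357; 3239; 180; 1721; 146; 2587; 1649;
     1438; 2323; 2885; 3296; 1568; 1169; 2613; 894; 487];
  [:: 751; 2951; 2555; 216; 2097; 1316; 1500; 1194; 317; 353; 992; 1157; 2811; 958; 844; 2665; 2958;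
     89; 2038; 2345; 467; 3224; 1924; 1099; 1833; 2244; 1981; 2445; 1519; 883; 2709; 1432; 770;
     2274; 1598; 3086; 2188; 3361; 584; 1385; 567; 438; 1796; 3022; 2428; 1661; 3273; 652; 2738;
     3162; 2527; 40; 2878; 150; 1875; 1731; 232; 1244];
  [:: 234; 1896; 2698; 3140; 3065; 2832; 1970; 1311; 337; 3262; 2071; 3324; 2925; 2282; 2779; 2325;
     803; 17; 411; 3088; 1714; 2098; 570; 197; 358; 947; 2161; 2593; 1984; 1533; 1401; 1604; 2433;
     2983; 831; 1207; 747; 1131; 2661; 2460; 1817; 3212; 499; 2205; 82; 1342; 2891; 1753; 1482; 900;
     1064; 1231; 1025; 154; 615; 2526; 690; 1656];
  [:: 2571; 2000; 239; 516; 2723; 53; 656; 696; 1892; 1352; 1211; 453; 946; 3209; 1785; 386; 1395;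
     884; 1663; 1010; 2371; 2137; 188; 1590; 2303; 2742; 1229; 2895; 1532; 69; 1701; 2463; 2962;
     2903; 2224; 3189; 2550; 1852; 3113; 629; 3284; 3062; 1084; 2803; 2036; 2158; 2388; 573; 3315;
     1930; 345; 2640; 156; 1475; 846; 1106; 764; 1280];
  [:: 326; 635; 755; 1349; 2140; 3165; 431; 2227; 739; 2437; 1916; 2051; 1745; 1594; 2559; 896;
     2275; 1149; 1240; 210; 2516; 3046; 1033; 2776; 1326; 2611; 1472; 2010; 2394; 864; 2887; 3120;
     3200; 2361; 249; 3351; 75; 497; 2947; 1847; 3265; 1170; 1700; 153; 403; 2804; 578; 2189; 1653;
     939; 3; 1891; 1060; 1421; 641; 2705; 3002; 1529];
  [:: 837; 157; 2569; 1050; 2160; 938; 377; 681; 2131; 419; 2766; 1855; 1115; 1024; 2953; 2470; 327;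
     2297; 3090; 1879; 926; 1415; 482; 2028; 2422; 282; 2881; 2355; 1931; 734; 3250; 1353; 102;
     1667; 2510; 1188; 782; 1787; 1514; 3199; 3354; 2251; 1285; 2814; 9; 575; 2642; 1219; 1450; 202;
     2040; 1711; 2703; 2990; 3049; 608; 1567; 3155];
  [:: 1671; 2562; 1446; 2310; 2175; 595; 1815; 1384; 2867; 65; 2926; 26; 769; 2094; 1464; 1724; 698;
     3266; 1029; 3112; 2791; 1750; 3233; 1950; 2037; 881; 2753; 668; 2443; 1095; 425; 240; 1124;
     2213; 1888; 1999; 853; 171; 2400; 2707; 2333; 1576; 521; 184; 563; 3003; 3071; 3172; 3321;
     2644; 376; 1186; 1549; 1317; 344; 967; 2540; 1241];
  [:: 1263; 288; 486; 902; 3192; 1014; 2551; 123; 828; 382; 54; 1091; 3102; 90; 3281; 2750; 2174;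
     1603; 2247; 2945; 2100; 2290; 417; 2596; 3058; 1859; 329; 2836; 1394; 666; 3363; 2971; 1760;
     1921; 2847; 1722; 187; 3154; 2002; 1807; 1647; 1348; 2466; 2380; 2652; 1146; 1189; 706; 1479;
     786; 2087; 568; 1299; 2363; 2678; 1520; 952; 616];
  [:: 2296; 2417; 2171; 1431; 362; 2755; 1699; 2964; 77; 628; 796; 251; 2446; 1792; 2077; 3305;
     1253; 1638; 2132; 1512; 678; 1047; 1826; 1126; 1605; 2013; 20; 1306; 966; 1036; 2508; 434;
     1927; 2655; 1505; 2812; 2332; 498; 339; 554; 2710; 2567; 138; 2848; 3331; 1199; 2235; 3226;
     3047; 835; 2914; 3123; 3132; 183; 1905; 1338; 872; 735];
  [:: 1884; 3322; 908; 581; 2880; 841; 87; 2457; 1947; 2500; 2769; 1678; 2265; 3094; 3177; 247;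
     2722; 2225; 1077; 336; 127; 37; 1274; 2154; 1455; 2639; 186; 1215; 2801; 427; 1143; 2014; 968;
     2424; 566; 3215; 488; 2906; 1417; 2976; 684; 1615; 804; 3045; 2606; 354; 1685; 1277; 2035;
     1534; 3295; 1794; 716; 2331; 1377; 2090; 1853; 1003];
  [:: 813; 1460; 1639; 3243; 253; 224; 935; 571; 2576; 2499; 1813; 3161; 2; 2064; 1430; 3121; 2120;
     1525; 1582; 2651; 1747; 669; 2427; 2250; 2928; 2360; 1203; 630; 2754; 3350; 2966; 454; 141;
     496; 2788; 909; 1023; 369; 728; 1929; 2312; 2439; 1386; 1137; 1309; 3286; 83; 1269; 2850; 1979;
     1730; 2683; 771; 1870; 1066; 2157; 3069; 328];
  [:: 3301; 2402; 609; 2645; 2876; 1139; 931; 893; 514; 3219; 31; 683; 2492; 1874; 1695; 2207; 196;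
     1173; 319; 2782; 772; 1481; 162; 455; 1584; 2053; 1302; 1080; 2968; 854; 3111; 73; 1659; 2919;
     2003; 1786; 2285; 1414; 1508; 1237; 564; 1343; 1917; 3341; 1027; 2180; 378; 2830; 1827; 2327;
     3039; 3150; 2700; 263; 2598; 2512; 2124; 720];
  [:: 2952; 2381; 619; 1962; 352; 151; 3180; 3042; 2212; 2464; 1765; 1453; 2009; 1201; 1118; 1224;
     3126; 797; 540; 3307; 3278; 1374; 1535; 875; 2118; 1845; 863; 207; 1729; 2972; 2200; 1044;
     2837; 1009; 2747; 750; 2882; 433; 2530; 272; 659; 929; 1631; 1423; 2375; 48; 97; 2284; 2061;
     2561; 1869; 297; 3194; 1312; 1579; 2704; 513; 2636];
  [:: 1801; 1779; 230; 2653; 1437; 3176; 3000; 1331; 2455; 842; 1004; 1643; 604; 2946; 0; 1708;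
     3228; 1264; 2854; 1082; 3100; 449; 741; 950; 2564; 2167; 2324; 2236; 2045; 2519; 2676; 334;
     3256; 1564; 167; 1960; 653; 1387; 2299; 370; 68; 1858; 3060; 1109; 2749; 2434; 515; 2806; 529;
     1182; 2136; 3316; 1595; 757; 1469; 880; 2022; 244];
  [:: 314; 1427; 3107; 101; 1956; 199; 118; 349; 982; 1391; 2960; 1849; 910; 3163; 1861; 2192; 583;
     542; 2913; 2822; 1200; 25; 730; 2736; 3247; 1755; 442; 2401; 3347; 2630; 1507; 1989; 2218;
     2441; 1322; 1063; 2671; 829; 2082; 1626; 2602; 1127; 503; 2089; 2495; 1543; 1013; 2884; 2349;
     1233; 792; 2317; 1623; 3040; 1732; 273; 3267; 645];
  [:: 2875; 1209; 731; 2605; 456; 2104; 2407; 1778; 2973; 1462; 3335; 3028; 3183; 2373; 1102; 255;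
     3198; 3302; 134; 1925; 2797; 1382; 1305; 2689; 2490; 177; 783; 2916; 1803; 1881; 489; 1610;
     2259; 993; 2730; 596; 1683; 110; 1424; 865; 1262; 552; 1086; 3104; 2302; 39; 891; 2024; 338;
     1681; 951; 647; 1530; 2056; 350; 2505; 2643; 2149];
  [:: 565; 473; 3263; 1255; 3340; 341; 3182; 1487; 1008; 116; 1192; 94; 1975; 2458; 2110; 2975;
     1447; 2575; 1388; 1808; 1048; 763; 3234; 1616; 1624; 2657; 3050; 655; 45; 1537; 2152; 965;
     2421; 264; 2734; 2688; 394; 2899; 633; 2939; 2799; 215; 1938; 406; 2511; 2066; 2339; 826; 1776;
     3093; 877; 1726; 2292; 727; 1140; 2230; 1912; 1284];
  [:: 1180; 285; 357; 3115; 1492; 2548; 2305; 1640; 1366; 3142; 435; 2675; 572; 3026; 293; 2330;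
     1114; 857; 2649; 2911; 715; 3312; 2067; 1558; 598; 506; 1300; 999; 1830; 195; 657; 2459; 2023;
     1410; 3264; 86; 3205; 1944; 1885; 759; 2238; 2767; 963; 1617; 2143; 133; 1053; 10; 2823; 1268;
     1771; 2202; 2420; 1719; 916; 2969; 2857; 2594];
  [:: 1074; 1898; 2309; 2181; 2076; 1136; 1768; 1451; 3280; 1222; 636; 2679; 2751; 2389; 4; 3095;
     1660; 468; 421; 2436; 405; 2607; 754; 200; 524; 667; 3242; 2872; 2628; 3328; 3148; 1620; 2941;
     1000; 2206; 2807; 2974; 1710; 99; 970; 2533; 2029; 712; 1555; 1828; 2321; 1334; 278; 1958; 834;
     1214; 3038; 2142; 136; 332; 924; 1419; 1304];
  [:: 2301; 2692; 140; 432; 855; 1800; 671; 2257; 701; 2151; 589; 1260; 3083; 903; 2989; 1741; 1665;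
     2794; 984; 2128; 1698; 2940; 2871; 987; 1948; 3024; 2604; 1871; 2406; 1614; 2547; 2484; 104;
     301; 2353; 179; 1120; 3134; 3244; 1547; 809; 1197; 2646; 32; 3334; 2043; 1454; 550; 1292; 371;
     1363; 519; 1399; 1072; 287; 1997; 3275; 2775];
  [:: 2196; 1934; 1873; 2560; 1538; 2785; 2741; 2978; 124; 2278; 2032; 2935; 1187; 2242; 1625; 307;
     265; 2535; 204; 423; 2725; 953; 1994; 1398; 3342; 2471; 51; 1483; 1354; 2898; 1324; 559; 1795;
     72; 664; 1019; 3103; 1854; 1690; 870; 2116; 2429; 3272; 861; 587; 1123; 1057; 744; 781; 1613;
     2357; 3213; 3056; 404; 1271; 500; 2615; 3147];
  [:: 3291; 3325; 1823; 2452; 1445; 3143; 92; 298; 1705; 2912; 1344; 201; 3079; 2745; 1495; 3015;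
     836; 2868; 144; 492; 1971; 811; 1669; 694; 558; 1088; 878; 1030; 599; 1608; 2134; 1909; 2221;
     1119; 2681; 714; 2423; 2566; 3246; 238; 2033; 2840; 388; 1526; 2509; 1287; 1754; 2618; 2307;
     16; 1235; 2153; 2020; 440; 3054; 972; 1177; 2336];
  [:: 794; 2025; 1465; 2075; 2802; 1851; 1422; 2147; 111; 2558; 2859; 724; 879; 2091; 3326; 245;
     2497; 3108; 538; 2677; 985; 1365; 1897; 2348; 294; 2237; 1586; 658; 1096; 1672; 2411; 2901;
     1196; 818; 3018; 2485; 1; 1539; 1265; 1684; 355; 512; 147; 1321; 1130; 3235; 2667; 2959; 1777;
     1015; 458; 3297; 203; 2783; 588; 1955; 2318; 3157];
  [:: 917; 258; 391; 2556; 414; 1966; 1865; 1021; 1806; 1190; 190; 2232; 2005; 799; 1513; 2386;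
     3128; 3227; 2995; 2720; 3327; 833; 2320; 561; 1412; 106; 1226; 738; 1062; 1288; 2833; 1752;
     3171; 673; 2092; 46; 2929; 323; 1150; 2289; 143; 507; 3289; 2480; 2641; 2763; 1452; 1362; 2176;
     1597; 3070; 2544; 1632; 1682; 2845; 979; 2048; 607];
  [:: 2805; 480; 105; 1204; 1017; 2586; 618; 3151; 2366; 208; 1245; 2448; 1308; 57; 892; 268; 2304;
     1866; 2539; 1418; 3346; 446; 3007; 2088; 700; 1551; 2256; 163; 2874; 1474; 2930; 778; 2155;
     1583; 3208; 1748; 639; 932; 2085; 1919; 359; 3098; 3057; 1101; 1696; 1340; 3279; 1846; 2393;
     1658; 867; 300; 2780; 1982; 2612; 1147; 537; 2708];
  [:: 2796; 3167; 2781; 430; 3245; 767; 125; 2908; 941; 2185; 1282; 2130; 266; 209; 1996; 2474; 79;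
     1273; 3323; 1168; 1742; 3114; 2579; 2255; 1116; 2431; 2498; 1473; 479; 1654; 622; 850; 2694;
     3260; 1839; 1895; 1527; 1619; 2622; 2843; 1087; 1686; 1964; 3068; 729; 576; 1396; 52; 1336;
     2988; 2081; 2337; 348; 923; 2276; 340; 663; 1020];
  [:: 2849; 1825; 2121; 112; 2272; 2764; 2356; 1071; 1542; 2011; 1250; 602; 159; 2800; 3268; 897;
     1368; 1883; 2054; 2537; 556; 3025; 3359; 2166; 1593; 2724; 1012; 1416; 261; 820; 1496; 308; 11;
     1332; 2254; 1783; 3141; 1933; 1213; 452; 2970; 3127; 638; 375; 2638; 2483; 936; 3211; 760; 466;
     2416; 221; 704; 1134; 1738; 2568; 1646; 2900];
  [:: 654; 2701; 2592; 2346; 1040; 279; 2210; 3191; 3313; 3259; 2294; 67; 1045; 2531; 2866; 1820;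
     1587; 534; 2765; 2481; 1174; 1637; 623; 3186; 817; 1920; 1254; 2197; 160; 226; 1689; 1524;
     1330; 2979; 1775; 395; 1129; 3037; 2019; 3118; 983; 309; 905; 1372; 2942; 494; 1880; 761; 12;
     2065; 1486; 2378; 437; 2824; 725; 2658; 1393; 2139];
  [:: 3092; 1676; 1559; 1141; 631; 699; 3067; 1489; 3300; 662; 2580; 2784; 257; 1441; 2543; 2057;
     1735; 439; 400; 925; 22; 2473; 758; 3181; 1069; 3318; 2264; 1816; 2426; 2138; 2159; 1228; 1995;
     2842; 859; 464; 117; 1166; 228; 1886; 2759; 2335; 2963; 1945; 95; 1761; 2673; 2260; 933; 310;
     1591; 2650; 3195; 532; 1315; 1390; 2936; 998];
  [:: 660; 1499; 2820; 1844; 217; 2846; 3010; 3076; 1937; 2298; 478; 1195; 3358; 2956; 3206; 135;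
     237; 1022; 2713; 1589; 1056; 2198; 2768; 1234; 62; 709; 1973; 2438; 2370; 1521; 787; 3133;
     1301; 2542; 401; 2078; 2572; 886; 347; 1155; 1766; 3248; 1899; 606; 543; 47; 1709; 868; 3033;
     1448; 2409; 2125; 2241; 410; 2627; 1337; 1628; 956];
  [:: 1548; 1327; 129; 988; 2172; 182; 3034; 1360; 1821; 3288; 2326; 2922; 2756; 726; 1154; 1259;
     1596; 2006; 320; 508; 536; 2534; 2818; 860; 1404; 580; 2271; 2977; 374; 1694; 19; 2086; 1863;
     1217; 921; 2633; 1772; 2883; 2693; 457; 806; 58; 1670; 2220; 1049; 3360; 246; 1484; 692; 3202;
     2451; 2108; 973; 2597; 3166; 3074; 2403; 1954];
  [:: 262; 1098; 2177; 849; 3116; 1746; 2838; 2229; 76; 610; 693; 2637; 2412; 343; 1504; 2472; 2752;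
     2869; 927; 1225; 708; 1972; 991; 1378; 2585; 2268; 3217; 3261; 2070; 756; 422; 194; 1836; 3035;
     1636; 1133; 942; 1687; 130; 548; 1857; 3175; 1439; 2931; 2682; 3001; 517; 1953; 2507; 2358;
     1607; 1198; 1518; 3344; 2103; 367; 38; 1328];
  [:: 1238; 3048; 856; 1774; 2920; 3287; 2486; 2965; 1581; 1051; 885; 1922; 393; 2031; 1276; 292;
     2778; 697; 2390; 18; 2026; 530; 1498; 520; 1645; 2532; 1148; 109; 122; 2112; 2664; 3080; 1890;
     612; 2825; 802; 2712; 3222; 1819; 648; 1183; 1693; 2226; 280; 1026; 1556; 976; 2184; 1369;
     3317; 3168; 415; 1434; 2287; 2584; 2328; 2870; 227];
  [:: 1065; 3330; 205; 2858; 1736; 1444; 2467; 2786; 1142; 1832; 3184; 2905; 737; 360; 2961; 1467;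
     2102; 852; 450; 1313; 1751; 60; 1544; 1677; 2514; 959; 901; 3292; 3223; 2372; 2656; 2049; 2744;
     164; 346; 2600; 1041; 1992; 650; 243; 774; 3036; 1167; 2397; 1355; 2669; 2300; 1969; 1910;
     2243; 472; 620; 1230; 2162; 528; 13; 3106; 1602];
  [:: 5; 1212; 2352; 2262; 443; 1251; 670; 1380; 775; 3109; 3285; 270; 1436; 1913; 483; 2190; 330;
     2060; 986; 964; 2815; 2129; 1569; 3229; 2518; 2469; 1963; 1764; 547; 1697; 1093; 2204; 2391;
     2591; 1517; 632; 3309; 1974; 2943; 2987; 1629; 96; 189; 718; 356; 2702; 1333; 165; 2865; 3178;
     922; 827; 2739; 2635; 1843; 3051; 1457; 1105];
  [:: 372; 1531; 2482; 295; 978; 1400; 1375; 1480; 2932; 560; 2809; 1728; 3077; 990; 1860; 214;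
     2552; 1075; 1609; 1162; 1651; 2004; 126; 1318; 103; 2662; 675; 420; 2758; 2350; 3190; 510;
     3277; 717; 801; 907; 2877; 2697; 1961; 2219; 1793; 3357; 2164; 2387; 1236; 621; 235; 825; 3136;
     2273; 2080; 2114; 28; 3006; 1159; 2525; 1812; 3072]]%num.

Lemma square_table58 : square_table 58 97527 218688043 table58.
Proof. by vm_compute. Qed.

Definition row_codes58 : seq nat :=
  nseq 29 0 ++
  [:: 0; 4; 3; 0; 2; 3; 0; 4; 2; 0; 1; 2; 1; 5; 2; 2; 5; 0; 2; 2; 3; 4; 1; 2; 5; 2; 0; 0; 5].

Definition col_codes58 : seq nat :=
  [:: 5; 1; 2; 2; 3; 5; 4; 2; 0; 5; 0; 3; 2; 3; 3; 3; 0; 1; 1; 2; 0; 2; 4; 4; 4; 4; 3; 0; 3; 0; 5;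
     0; 2; 0; 5; 4; 1; 0; 5; 5; 1; 4; 5; 3; 1; 1; 4; 5; 3; 4; 4; 0; 0; 0; 2; 4; 2; 4].

Lemma triple_codes58 : triple_codes 58 97527 table58 row_codes58 col_codes58.
Proof. by vm_compute. Qed.

Definition table62 : seq (seq N) := [::
  [:: 2559; 418; 497; 3105; 271; 3730; 3661; 3638; 2447; 2344; 2533; 489; 3230; 2614; 2169; 1622;
     339; 913; 1463; 65; 1391; 988; 2769; 1361; 3510; 3539; 812; 3167; 2909; 1907; 2965; 634; 1113;
     618; 3429; 1263; 1940; 3037; 3402; 3083; 1694; 1190; 2260; 3790; 194; 1605; 1996; 2704; 1549;
     1811; 1007; 2804; 1174; 2406; 158; 696; 2184; 10; 2104; 1747; 765; 3341];
  [:: 3642; 936; 1309; 3679; 2434; 2591; 1760; 2100; 3595; 804; 2885; 639; 2503; 1011; 3796; 2351;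
     3738; 170; 3150; 421; 95; 219; 926; 1067; 2987; 2268; 3185; 2971; 14; 1659; 3334; 520; 249;
     3272; 2370; 2218; 2728; 467; 3478; 350; 1194; 3369; 2000; 1852; 609; 682; 2167; 2806; 867;
     1396; 2699; 3053; 3432; 1717; 1426; 1491; 1951; 2632; 1294; 1590; 1118; 1897];
  [:: 3444; 2659; 1624; 259; 2224; 3327; 2866; 2725; 717; 3552; 3116; 2446; 2554; 898; 370; 956;
     2134; 3396; 2930; 3528; 3832; 206; 1513; 836; 1443; 1730; 1161; 3073; 499; 3194; 3233; 1570;
     2243; 1248; 413; 1; 1855; 102; 3600; 3682; 647; 1909; 2310; 1378; 2738; 785; 160; 3016; 1785;
     1349; 2807; 2485; 1985; 2411; 2086; 3745; 1103; 1049; 1977; 1217; 578; 454];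
  [:: 1405; 238; 3772; 2887; 175; 3345; 2959; 691; 774; 2429; 316; 1356; 1086; 616; 2775; 3839; 297;
     2162; 2249; 3410; 1048; 2618; 3524; 1709; 951; 2081; 46; 2562; 3281; 1563; 1506; 2177; 3222;
     2015; 3114; 2376; 513; 457; 1189; 1127; 826; 3007; 1271; 1774; 3377; 1454; 659; 3603; 1949;
     3678; 88; 3585; 427; 887; 1649; 1807; 2299; 2814; 2515; 2675; 3051; 1878];
  [:: 955; 3483; 817; 2238; 2842; 1188; 3803; 607; 3358; 473; 2981; 3430; 3160; 180; 97; 2764; 3197;
     2476; 688; 2051; 1804; 3276; 2534; 1795; 295; 1952; 389; 2369; 1629; 1305; 2013; 3092; 665;
     2348; 3764; 3711; 1100; 1153; 998; 552; 1247; 1695; 746; 3578; 1560; 2568; 2629; 1460; 927;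
     2925; 2913; 1406; 3653; 11; 364; 1894; 2170; 2666; 234; 2119; 3290; 1546];
  [:: 791; 1567; 1162; 3599; 1025; 3780; 2724; 3; 221; 1428; 653; 2225; 3095; 2412; 3107; 2847;
     3525; 2954; 1193; 132; 1835; 3680; 2548; 3372; 434; 2065; 99; 2662; 1241; 3224; 2120; 398;
     1971; 1397; 3443; 3823; 2312; 2431; 550; 1070; 3180; 298; 3584; 2984; 2497; 2012; 2855; 737;
     1715; 866; 1623; 1512; 3318; 1338; 1790; 367; 970; 592; 1877; 886; 2770; 2244];
  [:: 3315; 944; 2068; 2757; 317; 3540; 1235; 2876; 1786; 80; 1828; 2833; 1154; 2155; 3423; 1347;
     1370; 1656; 3405; 832; 450; 3217; 1533; 713; 1273; 403; 280; 772; 2510; 3473; 142; 1571; 2943;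
     3812; 2284; 3746; 1972; 2008; 3121; 2455; 596; 897; 2389; 664; 3229; 3024; 518; 207; 2694;
     1020; 1101; 2550; 3070; 2188; 2318; 33; 3630; 1883; 3691; 1731; 2645; 1456];
  [:: 36; 1824; 2367; 1402; 1243; 3018; 3455; 1963; 3725; 2834; 507; 2096; 3091; 2129; 1474; 1325;
     577; 3819; 217; 3541; 954; 74; 1671; 1114; 164; 2705; 3232; 776; 1686; 2555; 3499; 3640; 2897;
     1179; 2285; 2181; 320; 738; 3389; 1998; 1165; 408; 2480; 2953; 3296; 3188; 1498; 909; 1912;
     2443; 645; 831; 2617; 1030; 262; 3705; 1794; 486; 2327; 1594; 3131; 2759];
  [:: 1869; 3580; 119; 381; 2471; 2736; 873; 2277; 1490; 2646; 3804; 971; 1483; 1604; 2338; 3288;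
     1779; 1931; 3463; 2106; 3124; 53; 443; 2148; 2484; 1038; 2957; 833; 2839; 726; 3079; 3189;
     2226; 660; 570; 2022; 200; 3348; 3706; 2990; 1680; 263; 1222; 1653; 3620; 137; 771; 3249; 3491;
     3731; 526; 1297; 1853; 2858; 1331; 1143; 333; 1061; 2393; 2573; 2716; 1388];
  [:: 2024; 1482; 1556; 820; 2401; 3817; 963; 3029; 3231; 15; 559; 1529; 651; 2483; 1696; 3200;
     1394; 3610; 1267; 2138; 1797; 3088; 1844; 1655; 3676; 2651; 3529; 308; 2317; 2057; 2924; 3346;
     3141; 1967; 2803; 1082; 2175; 3766; 1203; 2687; 509; 2862; 1324; 480; 82; 1139; 1917; 3387;
     3544; 2577; 1043; 868; 2772; 226; 795; 2242; 392; 2435; 330; 3425; 731; 172];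
  [:: 2201; 3206; 852; 1035; 223; 3424; 914; 572; 1495; 1216; 3365; 2626; 1826; 3013; 2357; 1471;
     400; 2444; 2518; 714; 2132; 2886; 103; 3591; 3077; 2673; 1721; 789; 479; 1315; 3486; 3767;
     1240; 643; 1092; 2233; 1796; 1389; 1901; 131; 363; 3683; 524; 1662; 3247; 3654; 2748; 2940;
     252; 2325; 1144; 986; 7; 3110; 2553; 2844; 1561; 2074; 3810; 3316; 2044; 1970];
  [:: 2; 2907; 114; 1904; 2234; 1616; 2931; 2985; 124; 3101; 3813; 1293; 2696; 674; 830; 3401; 2642;
     941; 3040; 1783; 3340; 2076; 1122; 2294; 1466; 3201; 229; 3271; 805; 1332; 548; 1096; 2504;
     910; 1575; 407; 1948; 3605; 318; 1385; 2361; 1010; 1859; 3566; 3748; 3520; 703; 2783; 2208;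
     1488; 582; 3688; 3431; 290; 2439; 1728; 2034; 2846; 470; 2551; 2160; 1205];
  [:: 3672; 3492; 2309; 2819; 1536; 633; 3468; 1445; 358; 3386; 1377; 2658; 1704; 276; 1832; 1780;
     1116; 2381; 419; 2253; 37; 3179; 1640; 3555; 1896; 3770; 742; 1355; 2077; 1956; 225; 2900; 505;
     3307; 3034; 2493; 447; 1282; 1044; 1993; 3814; 1181; 2452; 806; 71; 2210; 983; 3057; 3109; 906;
     3643; 2731; 2710; 793; 2133; 3260; 1109; 1587; 579; 151; 2936; 2561];
  [:: 3209; 1601; 2329; 1042; 2288; 2507; 2795; 2230; 1507; 1987; 1202; 1404; 30; 2958; 216; 3339;
     2664; 1895; 3504; 3794; 1834; 2786; 3577; 306; 1272; 3628; 3225; 356; 2718; 386; 1746; 2071;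
     3674; 3003; 2131; 2454; 1437; 1620; 566; 138; 3137; 1685; 670; 3096; 1135; 2360; 1320; 1110;
     3779; 485; 835; 2546; 722; 782; 982; 2856; 516; 63; 3411; 3351; 880; 1983];
  [:: 448; 3667; 3390; 974; 1547; 600; 348; 2750; 740; 1187; 3268; 2417; 3042; 3446; 420; 1374;
     2441; 117; 3175; 649; 760; 822; 2817; 3551; 157; 3000; 1867; 3519; 2951; 501; 2513; 3336; 3808;
     1690; 2894; 1062; 3622; 2053; 1166; 1014; 2283; 1475; 3120; 1625; 2640; 2703; 13; 2198; 1784;
     275; 1314; 911; 2026; 2331; 1577; 2149; 1249; 246; 1927; 3778; 1836; 2570];
  [:: 1407; 1958; 635; 3559; 1643; 2158; 3147; 1002; 2547; 3097; 2685; 5; 3439; 2481; 1172; 2374;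
     3374; 239; 3279; 2084; 2333; 3001; 130; 107; 1752; 1448; 3702; 2625; 397; 965; 341; 1916; 3192;
     1710; 2250; 2864; 458; 1579; 2789; 3310; 1518; 2463; 781; 283; 2836; 2969; 3495; 1815; 3626;
     521; 3783; 697; 883; 1258; 1227; 857; 1344; 3727; 2200; 583; 2002; 1111];
  [:: 2191; 1863; 1478; 2767; 1142; 1528; 1301; 2810; 2560; 921; 1553; 3694; 504; 1077; 3615; 3298;
     2607; 482; 1390; 3550; 20; 3400; 2145; 3454; 1843; 327; 2721; 641; 3099; 2092; 685; 1343; 188;
     800; 976; 1964; 2880; 847; 148; 580; 1199; 2330; 1692; 2368; 3512; 2922; 3008; 2438; 3186;
     3265; 2506; 105; 3133; 380; 3733; 2042; 3784; 1670; 1052; 2289; 267; 1768];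
  [:: 1351; 254; 2711; 1805; 2349; 2030; 1580; 3558; 3818; 3156; 491; 1751; 2960; 40; 1457; 627;
     1961; 402; 111; 3721; 2114; 2572; 2495; 3668; 3445; 845; 3607; 2792; 134; 1548; 1701; 2410;
     933; 3522; 1234; 2634; 3075; 1651; 2235; 1911; 1171; 3187; 1080; 2097; 2453; 3011; 2869; 508;
     353; 684; 928; 1256; 231; 992; 3333; 569; 2211; 744; 1424; 3366; 2740; 3267];
  [:: 2070; 621; 3800; 248; 3407; 945; 1398; 28; 2558; 2468; 1287; 1201; 2239; 1722; 2702; 2986;
     3441; 2798; 3489; 1738; 3331; 881; 1177; 546; 1003; 3753; 585; 1617; 1953; 3256; 159; 1517;
     2653; 2955; 3154; 2045; 2137; 123; 3641; 3181; 2735; 2539; 704; 839; 1808; 788; 3044; 463;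
     1427; 220; 3548; 383; 2324; 3713; 2179; 1360; 1115; 2363; 371; 1886; 2903; 1608];
  [:: 2304; 3329; 2477; 3840; 2902; 1763; 1242; 843; 3380; 2809; 1455; 681; 2397; 171; 2061; 1155;
     3002; 1072; 2778; 2670; 273; 899; 1829; 2180; 2571; 3129; 3061; 3456; 91; 994; 1945; 732; 2538;
     2611; 1539; 1860; 3173; 590; 987; 1992; 1379; 3773; 1306; 2282; 527; 1592; 355; 428; 3237;
     3536; 3508; 3652; 1614; 792; 243; 444; 2111; 2935; 1207; 24; 3718; 1689];
  [:: 237; 3136; 1755; 2027; 1175; 1106; 3242; 838; 3503; 522; 253; 1684; 2394; 3838; 729; 311;
     3176; 2873; 3618; 468; 2643; 1633; 2147; 1013; 780; 2248; 1838; 2692; 3015; 2928; 2598; 3367;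
     3697; 1888; 156; 1342; 3461; 2843; 964; 1197; 2182; 2073; 72; 3543; 3303; 1558; 2519; 3087; 49;
     1449; 644; 2298; 563; 2733; 923; 3758; 411; 1526; 1286; 1939; 1421; 2461];
  [:: 2041; 64; 176; 2163; 3709; 1440; 59; 3590; 1699; 236; 2650; 3816; 3379; 3530; 1120; 3221;
     2762; 2526; 1969; 2945; 2545; 2423; 2677; 1739; 414; 3433; 2356; 366; 878; 2977; 2828; 1578;
     1872; 1371; 2341; 1825; 3067; 1230; 1081; 959; 2857; 291; 723; 3118; 2094; 1260; 999; 1350;
     1619; 3278; 749; 2217; 2236; 3735; 436; 677; 1494; 861; 3295; 598; 536; 3655];
  [:: 2777; 2056; 192; 483; 3687; 528; 2827; 1304; 1955; 854; 1762; 901; 939; 3729; 1568; 2492; 42;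
     3481; 2293; 739; 3023; 122; 167; 2590; 3255; 1719; 2680; 2465; 1169; 3297; 251; 1866; 368;
     1015; 2898; 3581; 3651; 1381; 1191; 3831; 2413; 3059; 2157; 2323; 2176; 1504; 373; 3428; 1841;
     3127; 3174; 1447; 678; 1246; 3404; 2918; 1668; 2639; 2017; 1065; 763; 584];
  [:: 798; 300; 1703; 465; 1930; 3593; 2456; 3442; 1772; 90; 2127; 2609; 9; 2037; 3613; 1295; 589;
     2409; 1521; 2101; 1366; 3171; 3309; 1569; 1136; 1032; 2768; 814; 2722; 1846; 2557; 1063; 2944;
     187; 3828; 424; 182; 2514; 3744; 1453; 3399; 556; 3472; 879; 1642; 2982; 2793; 3700; 1228; 666;
     1885; 2346; 1327; 3151; 2252; 3039; 3284; 2207; 2867; 314; 950; 706];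
  [:: 2319; 1028; 3614; 1879; 2563; 842; 1550; 179; 1687; 3517; 698; 2426; 2231; 2517; 754; 1128;
     3071; 301; 1532; 209; 1200; 3210; 3685; 542; 1791; 334; 2003; 4; 2623; 972; 3417; 1458; 2813;
     425; 877; 3756; 3251; 1666; 2763; 3357; 2973; 1268; 115; 2126; 2269; 3833; 1088; 1818; 1328;
     636; 2380; 1979; 1411; 2679; 3146; 2067; 474; 2877; 3301; 3035; 568; 3570];
  [:: 1091; 126; 3328; 593; 12; 2583; 1415; 2797; 1031; 279; 3606; 1724; 3496; 372; 1300; 690; 1871;
     1788; 3165; 957; 204; 2055; 2029; 1208; 360; 3157; 1929; 3017; 2257; 3050; 1352; 3704; 3257;
     2416; 1837; 2752; 1480; 3724; 2682; 2219; 440; 1581; 885; 3788; 825; 676; 2500; 2337; 2136;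
     2648; 514; 2424; 2906; 1489; 3381; 1654; 3572; 803; 101; 2938; 1163; 3459];
  [:: 1186; 293; 2693; 2379; 3043; 2144; 3153; 2542; 3006; 1823; 3254; 3208; 1682; 3761; 2606; 743;
     1766; 1097; 642; 1636; 2251; 1034; 1874; 455; 1432; 775; 889; 2779; 2494; 3384; 2023; 1158;
     352; 2313; 3822; 3314; 1973; 846; 2105; 1412; 388; 3554; 1574; 32; 3715; 1340; 961; 1544; 2796;
     2450; 2946; 75; 1288; 571; 2190; 140; 3625; 3440; 2861; 241; 3526; 534];
  [:: 2270; 940; 1226; 3227; 451; 1312; 2630; 2489; 1737; 871; 2816; 1026; 2917; 1733; 1418; 1125;
     2040; 166; 349; 856; 2667; 1540; 535; 1799; 3637; 2766; 1873; 2390; 2479; 3749; 620; 1648; 296;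
     3523; 2544; 2892; 1093; 391; 3843; 3393; 790; 3093; 58; 1928; 3684; 3308; 1485; 2301; 94; 2060;
     2112; 604; 2214; 3172; 222; 3028; 1262; 686; 3594; 3453; 1600; 3108];
  [:: 1711; 1422; 3302; 462; 1749; 1140; 2850; 2028; 3392; 1583; 162; 3058; 1094; 1261; 2889; 79;
     3274; 981; 638; 2421; 1012; 2116; 404; 1473; 29; 2383; 1206; 2274; 289; 543; 2787; 1922; 2963;
     750; 1497; 602; 2656; 1302; 2050; 2521; 199; 1631; 2213; 2332; 2581; 3562; 3112; 3826; 3421;
     895; 1910; 3671; 2681; 2996; 3774; 1831; 720; 3474; 851; 359; 3636; 3183];
  [:: 2746; 2039; 3765; 1041; 2527; 16; 2209; 2457; 2246; 2937; 3397; 1414; 952; 3060; 3322; 2054;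
     1672; 3567; 3795; 551; 764; 3282; 208; 178; 2713; 1947; 1865; 2308; 3471; 1520; 1698; 2790;
     409; 631; 2875; 1132; 326; 1434; 3494; 2395; 3665; 1562; 3021; 711; 912; 121; 278; 587; 2151;
     2596; 2621; 3219; 1750; 1803; 1341; 819; 1104; 452; 3601; 1195; 3126; 1291];
  [:: 265; 3306; 2565; 2788; 2335; 759; 630; 1727; 948; 837; 3395; 77; 212; 3587; 453; 369; 907; 17;
     1812; 1769; 1348; 2161; 1060; 2221; 3012; 529; 1934; 2460; 2668; 2605; 1602; 422; 1289; 2402;
     1237; 1887; 3490; 3689; 3125; 1433; 3038; 2279; 2888; 1658; 2058; 2791; 2523; 3164; 185; 2974;
     574; 1036; 715; 1124; 1991; 3275; 3836; 3597; 3763; 1384; 1530; 3418];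
  [:: 3427; 3582; 329; 3347; 2737; 1436; 2964; 3696; 1713; 725; 415; 1329; 2223; 1211; 2532; 2278;
     2311; 2872; 475; 3220; 1806; 2473; 1059; 2832; 908; 611; 2047; 1976; 1253; 2543; 511; 862;
     3104; 1597; 3226; 2115; 1410; 3382; 2701; 991; 3062; 762; 44; 1759; 1884; 106; 1543; 622; 195;
     3781; 135; 1632; 277; 3596; 3824; 2373; 1045; 2036; 1131; 2615; 3506; 2976];
  [:: 1712; 719; 446; 1665; 1075; 2258; 1022; 3119; 1851; 1765; 1157; 2991; 2122; 21; 1535; 3701;
     655; 1889; 2949; 3239; 3470; 1593; 3557; 2466; 1486; 758; 1252; 3353; 2049; 232; 116; 2785;
     503; 2498; 3482; 1185; 1981; 2354; 285; 2890; 3728; 2821; 960; 558; 1401; 829; 375; 3047; 2043;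
     2717; 2592; 3791; 3612; 2215; 1336; 3330; 2378; 3203; 139; 929; 2619; 324];
  [:: 2884; 2586; 533; 818; 303; 977; 777; 3649; 108; 3712; 460; 3361; 2276; 2123; 2921; 1499; 2541;
     2059; 1995; 1744; 2436; 18; 3573; 1214; 1706; 1292; 3460; 565; 672; 2811; 1151; 1303; 3825;
     919; 1467; 393; 3241; 150; 3190; 3734; 699; 354; 3106; 3063; 1552; 228; 1881; 1017; 2771; 1078;
     1383; 1854; 2652; 2353; 2995; 3326; 3509; 1966; 2365; 1660; 2688; 2187];
  [:: 2883; 2328; 3553; 1085; 683; 210; 640; 1610; 133; 2154; 3801; 1439; 1492; 2264; 2947; 312;
     2408; 3332; 1935; 2660; 3089; 1387; 3485; 1229; 1646; 2709; 1245; 307; 1798; 748; 3412; 120;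
     968; 896; 1129; 1770; 3664; 3732; 2576; 553; 2078; 1316; 608; 2440; 2755; 3161; 3359; 1024;
     1868; 3263; 1677; 2823; 2530; 863; 2205; 51; 3199; 2031; 378; 3648; 488; 3036];
  [:: 2647; 2075; 286; 2773; 2358; 1589; 3673; 224; 3413; 1021; 3498; 3398; 315; 2009; 26; 1954;
     1408; 1095; 173; 2967; 2229; 1683; 614; 1542; 1875; 1215; 2442; 708; 3046; 3741; 947; 2998;
     442; 623; 3834; 1621; 778; 376; 1487; 2156; 2265; 3565; 89; 2911; 2524; 2303; 519; 2671; 2575;
     884; 3132; 3213; 1298; 2830; 1354; 864; 1817; 1757; 3608; 1138; 3236; 3321];
  [:: 500; 67; 2347; 2458; 3646; 1425; 1087; 2267; 412; 3364; 1016; 299; 2822; 3500; 3662; 1270;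
     1693; 3438; 3317; 3090; 1603; 3138; 2853; 2491; 2684; 2164; 3589; 1793; 1913; 2649; 787; 3807;
     152; 989; 1119; 632; 3169; 1988; 2742; 3771; 894; 2399; 331; 1615; 2186; 741; 2942; 1451; 1800;
     1936; 850; 31; 594; 1178; 1307; 3031; 1538; 3243; 2556; 2103; 245; 449];
  [:: 3811; 1479; 2983; 3305; 2529; 931; 3052; 588; 1618; 2585; 2117; 3629; 502; 202; 718; 2171;
     2010; 2706; 3488; 1862; 3751; 1264; 2427; 3111; 1944; 1359; 3717; 38; 394; 493; 1754; 853;
     2636; 2899; 92; 1393; 2919; 2098; 154; 3216; 2240; 2780; 1606; 332; 796; 272; 1047; 925; 1524;
     1083; 3277; 3371; 1160; 648; 1679; 2372; 1213; 3466; 2339; 3576; 2815; 1814];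
  [:: 1821; 3631; 902; 1285; 2794; 3264; 1224; 3168; 3032; 2292; 445; 1319; 3698; 2212; 1108; 2914;
     145; 3082; 2128; 2005; 1040; 1705; 786; 109; 3362; 2345; 816; 2486; 3805; 2549; 3564; 1673;
     2691; 274; 2467; 1515; 2048; 2366; 709; 2852; 3469; 597; 1417; 417; 55; 3750; 1438; 1892; 3294;
     2638; 624; 3159; 2784; 1756; 1933; 1176; 3532; 322; 540; 946; 1572; 191];
  [:: 2808; 3352; 3030; 3699; 2407; 60; 943; 1923; 2683; 3184; 215; 844; 3797; 430; 2025; 1209; 361;
     498; 2340; 652; 1598; 2109; 2099; 481; 753; 3337; 2968; 567; 1510; 127; 3415; 694; 1365; 3569;
     1848; 1156; 1764; 1918; 1023; 3736; 1265; 1107; 2613; 903; 3497; 1630; 3148; 258; 3619; 3253;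
     2774; 3080; 2199; 2291; 2474; 1318; 2865; 2566; 2501; 1732; 93; 1450];
  [:: 2384; 2196; 1891; 2165; 3311; 3408; 667; 3611; 2316; 3069; 3178; 1141; 1403; 904; 3419; 1514;
     1716; 707; 2641; 1090; 270; 3025; 2531; 1634; 1802; 439; 510; 755; 83; 8; 858; 405; 3122; 346;
     1924; 233; 2469; 1551; 2831; 985; 3518; 3240; 3802; 586; 1778; 1219; 2589; 2904; 2007; 3723;
     2281; 1444; 2932; 3690; 2776; 2690; 181; 1276; 2063; 1330; 1018; 3574];
  [:: 3422; 900; 2824; 2011; 2754; 112; 3737; 218; 1308; 2637; 2046; 396; 3300; 2478; 769; 669; 39;
     1057; 2307; 1849; 2166; 1269; 855; 1782; 477; 934; 2516; 3521; 1676; 3534; 3020; 304; 3065;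
     2920; 1238; 561; 1500; 3258; 1564; 695; 1968; 1004; 3152; 2261; 347; 1919; 2727; 1661; 165;
     1380; 3350; 2222; 3837; 1429; 531; 2602; 1123; 3162; 2893; 3645; 3708; 2359];
  [:: 1102; 1225; 882; 2761; 3786; 1845; 146; 2216; 1745; 2622; 2726; 1997; 86; 1982; 302; 848;
     1431; 1311; 2275; 3475; 3535; 203; 461; 3604; 1368; 547; 1006; 3158; 2334; 610; 3323; 3385;
     736; 2496; 2599; 2093; 1890; 3270; 3066; 978; 2110; 2826; 1508; 2970; 662; 2433; 1723; 6; 313;
     779; 2385; 3777; 3681; 3166; 2997; 1281; 2868; 3458; 382; 1117; 1657; 1609];
  [:: 1813; 2418; 3375; 2781; 849; 1419; 2342; 530; 1459; 235; 2512; 2587; 104; 1965; 2952; 292;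
     2140; 1133; 1718; 3677; 2237; 612; 1055; 3479; 3123; 870; 2633; 2695; 3464; 1198; 1251; 1781;
     2090; 3821; 3170; 143; 466; 996; 3740; 2001; 1905; 2203; 2841; 3579; 1334; 1645; 0; 1595; 962;
     3338; 3238; 730; 426; 2859; 1496; 2388; 3072; 757; 335; 3621; 3026; 657];
  [:: 2674; 2511; 1758; 2908; 1501; 3207; 3435; 937; 1335; 495; 1637; 3722; 2851; 1842; 3617; 3549;
     2962; 2603; 799; 1137; 197; 2273; 3287; 3378; 1576; 163; 2228; 1051; 1914; 517; 2305; 2006;
     809; 1221; 1707; 3149; 2079; 294; 1056; 3068; 3269; 110; 34; 2631; 2362; 3785; 2749; 2142;
     1392; 1925; 3719; 374; 918; 629; 3010; 1280; 328; 2451; 1442; 693; 3513; 619];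
  [:: 1363; 2375; 1850; 416; 3568; 2999; 198; 3695; 1864; 319; 2194; 1720; 1942; 824; 3252; 555;
     1376; 2972; 3324; 747; 3511; 256; 2488; 3376; 2419; 876; 3820; 2597; 575; 2655; 2262; 2020;
     1468; 3434; 1236; 2745; 487; 2860; 728; 3056; 2296; 2146; 1274; 70; 48; 1168; 3139; 1748; 2715;
     2835; 1611; 2064; 3743; 3193; 169; 1663; 3616; 1027; 1509; 930; 1076; 671];
  [:: 2091; 751; 810; 1566; 464; 401; 2730; 2302; 892; 3202; 1233; 625; 2014; 2564; 1921; 2805;
     1009; 2604; 76; 1776; 3155; 2391; 2910; 1469; 1974; 1099; 2174; 969; 2933; 266; 1858; 2445;
     1516; 2707; 2254; 183; 3467; 3516; 2130; 525; 2536; 1364; 3076; 1669; 1290; 47; 3349; 3714;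
     3623; 3022; 3560; 560; 342; 227; 3782; 1339; 712; 3720; 3248; 1130; 1734; 3312];
  [:: 255; 1284; 1505; 3841; 1029; 1641; 365; 1239; 827; 3019; 1079; 1400; 724; 3205; 2840; 1565;
     3244; 891; 484; 1446; 2306; 3537; 2612; 802; 2396; 938; 2916; 432; 2173; 3363; 2871; 193; 1926;
     539; 81; 1714; 35; 2697; 1870; 1840; 2425; 2066; 2247; 3084; 2756; 1777; 3650; 599; 3449; 2038;
     2113; 3299; 1323; 3686; 3533; 3754; 3142; 2579; 2540; 1146; 675; 128];
  [:: 3501; 2088; 2594; 1345; 768; 3447; 984; 1180; 2720; 168; 2854; 3609; 1588; 2108; 496; 2535;
     1638; 3117; 3342; 456; 337; 3759; 3545; 3195; 2220; 661; 2915; 3675; 3081; 2256; 2994; 2663;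
     2364; 3829; 1522; 1134; 57; 1830; 915; 2021; 385; 189; 2849; 1069; 1484; 2472; 3373; 2320; 615;
     689; 813; 993; 1674; 1978; 287; 118; 1266; 1903; 1399; 2747; 1771; 3228];
  [:: 663; 3656; 1856; 1557; 687; 1367; 1353; 1452; 3484; 2271; 1218; 3033; 2475; 2482; 2838; 3085;
     3546; 1525; 1950; 2552; 438; 1702; 100; 1005; 3755; 3313; 2941; 2698; 1257; 1664; 3809; 323;
     2350; 3436; 549; 872; 603; 1741; 2033; 3370; 205; 3234; 2204; 1084; 3669; 2087; 2665; 2739;
     2135; 141; 2912; 834; 3128; 1898; 431; 949; 288; 1148; 801; 2382; 27; 3163];
  [:: 1254; 1519; 410; 1833; 69; 1465; 2620; 3670; 2939; 3598; 2437; 506; 3325; 3223; 656; 177;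
     2891; 865; 1644; 1037; 50; 1607; 3140; 2567; 2315; 576; 1726; 3055; 2178; 2232; 980; 2095;
     2508; 922; 3388; 3830; 2168; 1126; 435; 2825; 3752; 745; 3235; 3477; 2398; 257; 340; 1946;
     1787; 2035; 2743; 1357; 2700; 3014; 196; 1900; 3462; 1204; 1068; 700; 3547; 1409];
  [:: 3182; 1416; 1627; 1591; 1275; 2121; 144; 2923; 716; 3074; 2080; 494; 3450; 2018; 1938; 2610;
     3250; 1337; 96; 2979; 2403; 2601; 942; 767; 3703; 3633; 3144; 260; 3787; 3505; 2734; 2802;
     1729; 2352; 395; 2280; 515; 1899; 564; 190; 3391; 2882; 3762; 3538; 1121; 658; 3344; 1819;
     1184; 1098; 325; 2192; 1470; 2525; 1046; 1541; 2470; 52; 1740; 2669; 920; 860];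
  [:: 1493; 2676; 905; 1941; 2245; 650; 1472; 1362; 66; 2143; 2782; 2574; 343; 3130; 1990; 1223;
     1743; 1071; 282; 2905; 3214; 2948; 2430; 41; 3775; 478; 770; 2520; 3293; 3627; 2415; 1880;
     1675; 3356; 1810; 433; 2326; 3266; 1296; 3693; 3054; 2107; 2800; 2183; 606; 3515; 541; 841;
     3806; 136; 1650; 1584; 2988; 186; 2654; 1152; 3586; 710; 997; 3416; 1413; 966];
  [:: 377; 1628; 2386; 979; 2732; 3191; 3588; 890; 840; 766; 174; 2870; 1792; 362; 2837; 3799; 1192;
     2975; 1430; 22; 1801; 3005; 2153; 3394; 1064; 3098; 1001; 437; 3739; 1585; 68; 3289; 2595;
     2272; 213; 3602; 3514; 2343; 1537; 1861; 1164; 595; 2509; 2661; 557; 3115; 2004; 309; 1313;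
     2195; 2052; 1386; 1244; 3451; 679; 3273; 721; 2686; 3659; 1735; 1962; 2462];
  [:: 1697; 1736; 523; 310; 2678; 1149; 1999; 752; 3571; 2405; 1613; 916; 3215; 1534; 1112; 471;
     264; 2624; 1050; 2765; 2102; 384; 62; 2185; 43; 3280; 240; 2801; 2878; 3406; 2125; 1333; 3292;
     734; 605; 3487; 2420; 3760; 1980; 815; 1596; 3789; 3143; 153; 1476; 3045; 2600; 2956; 1382;
     3666; 3457; 3004; 2537; 1259; 1882; 3635; 668; 975; 2314; 1212; 2259; 1809];
  [:: 54; 3291; 2459; 2322; 242; 1523; 2582; 1089; 702; 1652; 1708; 2227; 1986; 3368; 1358; 1147;
     147; 2741; 2845; 399; 2978; 573; 3556; 3639; 2896; 3259; 2118; 1857; 2255; 532; 2062; 3663;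
     1220; 888; 626; 3793; 2505; 1943; 1902; 269; 3776; 3078; 3452; 1279; 3134; 808; 3198; 1462;
     2961; 773; 2628; 1420; 953; 351; 2723; 84; 1582; 2371; 441; 1039; 1742; 3502];
  [:: 701; 2263; 3465; 3742; 214; 2400; 1820; 1074; 2926; 1761; 3048; 25; 935; 423; 1586; 3476; 184;
     2355; 1960; 2848; 1477; 345; 2989; 3335; 2016; 3355; 2432; 1626; 537; 2159; 1000; 78; 1531;
     2588; 859; 3707; 783; 2863; 1170; 1255; 2627; 924; 2085; 1310; 2487; 1678; 3103; 591; 3262;
     2753; 673; 1876; 261; 472; 3835; 2189; 2714; 3218; 1182; 1375; 3563; 3644];
  [:: 735; 1767; 2820; 3426; 3710; 2980; 1232; 1150; 2689; 1691; 2295; 3815; 1612; 2760; 3531; 1502;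
     1277; 2019; 1481; 3285; 3757; 2124; 2290; 2578; 3403; 2502; 230; 2895; 23; 637; 1073; 794; 601;
     250; 1908; 1326; 1554; 155; 2927; 917; 995; 828; 2449; 1423; 2377; 1847; 2202; 390; 336; 1932;
     3196; 3102; 73; 3624; 2616; 990; 3561; 3049; 2072; 538; 492; 3320];
  [:: 3343; 3647; 2448; 87; 2812; 2150; 247; 1321; 2608; 1555; 2193; 1464; 2874; 2089; 2993; 1278;
     1893; 3769; 1816; 1019; 2266; 2490; 545; 2929; 3064; 387; 875; 2593; 973; 797; 581; 3527; 1196;
     3177; 1959; 459; 161; 2336; 2404; 1503; 45; 3100; 3414; 3383; 692; 1994; 1753; 3283; 284; 2729;
     654; 344; 2708; 1700; 1173; 3716; 1369; 3542; 1667; 3827; 823; 1105];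
  [:: 1033; 2414; 2321; 562; 2751; 1775; 1461; 3135; 3792; 3027; 281; 2635; 869; 2032; 113; 2522;
     3768; 3448; 1145; 2287; 3507; 3041; 1681; 2584; 1250; 2083; 646; 3354; 3245; 2799; 2422; 3657;
     149; 1599; 211; 1639; 3212; 821; 61; 761; 1317; 490; 3583; 958; 406; 1183; 1066; 321; 1975;
     2141; 1906; 1511; 554; 2672; 3304; 2879; 1822; 727; 2966; 3658; 2206; 1395];
  [:: 3592; 2758; 3360; 1053; 2644; 268; 1441; 893; 733; 2428; 1915; 1283; 544; 19; 2528; 3660;
     3286; 201; 617; 1210; 2580; 811; 3086; 784; 3493; 2241; 1789; 2152; 429; 1054; 357; 1635; 3420;
     2300; 469; 2197; 1984; 1346; 1937; 1372; 1545; 3842; 1159; 3261; 1688; 3145; 3747; 3634; 967;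
     85; 1573; 125; 2392; 2069; 2881; 2818; 3009; 1839; 2719; 3204; 2934; 628];
  [:: 3575; 56; 2950; 874; 2657; 3726; 2744; 1725; 1231; 2712; 1008; 3798; 305; 2464; 932; 3692;
     3437; 1773; 1989; 2901; 2297; 2139; 1527; 1322; 379; 2082; 476; 756; 2172; 1957; 3211; 1559;
     1920; 3094; 3480; 1827; 3246; 3632; 1647; 1435; 512; 2499; 2829; 338; 1373; 1058; 680; 2286;
     2569; 807; 98; 3319; 2992; 3113; 2387; 613; 1167; 244; 3409; 1299; 705; 129]]%num.

Lemma square_table62 : square_table 62 119133 305258457 table62.
Proof. by vm_compute. Qed.

Definition row_codes62 : seq nat :=
  nseq 31 0 ++
  [:: 3; 3; 5; 2; 0; 1; 2; 2; 5; 0; 1; 0; 5; 3; 1; 3; 0; 4; 5; 4; 4; 0; 3; 5; 2; 1; 4; 2; 3; 4; 1].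

Definition col_codes62 : seq nat :=
  [:: 0; 4; 2; 3; 2; 3; 3; 3; 5; 4; 1; 5; 2; 5; 0; 1; 5; 2; 2; 2; 0; 3; 2; 0; 1; 0; 4; 4; 3; 2; 0;
     0; 5; 5; 4; 0; 1; 5; 1; 3; 2; 4; 5; 4; 5; 4; 2; 4; 0; 4; 3; 0; 2; 0; 3; 5; 4; 5; 4; 3; 3; 4].

Lemma triple_codes62 : triple_codes 62 119133 table62 row_codes62 col_codes62.
Proof. by vm_compute. Qed.

(** * All orders *)

(** Multiplication by 9 applies to any square, whereas tripling requires codes found for one
    particular table; powers of 3 are therefore absorbed two at a time. *)
Lemma has_square_mul9 m k : has_square m -> has_square (m * 9 ^ k).
Proof.
move=> hm; elim: k => [|k IH]; first by rewrite muln1.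
by rewrite expnSr mulnA; apply: has_square_mul => //; exact: has_square_table square_table9.
Qed.

Lemma has_square_lift m S Q T e e' : square_table m S Q T -> triple_codes m S T e e' ->
  m %% 4 = 2 -> 2 < m -> has_square m /\ has_square (m * 3).
Proof.
by move=> sT cT m4 m2; split; [apply: has_square_table sT | apply: has_square_triple sT cT].
Qed.

(** The order [m * 3] is included for the case that 3 divides the cofactor to an odd power. *)
Lemma has_square_base m : 8 <= m <= 64 -> m %% 4 = 2 -> has_square m /\ has_square (m * 3).
Proof.
move=> m64 m4.
have h10 : has_square 10 by exact: has_square_table square_table10.
have h30 : has_square 30 by exact: has_square_table square_table30.
have h9 k : has_square k -> has_square (k * 9) by exact: (@has_square_mul9 k 1).
have h5 k : k %% 4 = 2 -> 2 < k -> has_square k -> has_square (k * 5).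
  by move=> k4 k2; apply: has_square_coprime6.
have h14 : has_square 14 /\ has_square (14 * 3) by exact: (has_square_lift square_table14 triple_codes14 erefl erefl).
have h18 : has_square 18 /\ has_square (18 * 3) by exact: (has_square_lift square_table18 triple_codes18 erefl erefl).
have : m \in [:: 10; 14; 18; 22; 26; 30; 34; 38; 42; 46; 50; 54; 58; 62] by rewrite !inE; lia.
rewrite !inE; do ?[case/orP]; move=> /eqP ->.
- by [].
- exact: h14.
- exact: h18.
- exact: (has_square_lift square_table22 triple_codes22 erefl erefl).
- exact: (has_square_lift square_table26 triple_codes26 erefl erefl).
(* The order 30 * 3 is the numeral 10 * 9 by computation; the other composite orders below are
   identified in the same way. *)
- by split; last exact: h9 h10.
- exact: (has_square_lift square_table34 triple_codes34 erefl erefl).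
- exact: (has_square_lift square_table38 triple_codes38 erefl erefl).
(* 42 = 14 * 3 and 126 = 14 * 9. *)
- by split; [exact: h14.2 | exact: h9 h14.1].
- exact: (has_square_lift square_table46 triple_codes46 erefl erefl).
(* 50 = 10 * 5 and 150 = 30 * 5, the factor 5 being prime to 6. *)
- by split; [exact: h5 h10 | exact: h5 h30].
(* 54 = 18 * 3 and 162 = 18 * 9. *)
- by split; [exact: h18.2 | exact: h9 h18.1].
- exact: (has_square_lift square_table58 triple_codes58 erefl erefl).
- exact: (has_square_lift square_table62 triple_codes62 erefl erefl).
Qed.

(** Keeps the order 2 mod 4, as the sign pattern requires, once powers of 3 have been absorbed into
    it. *)
Lemma mod4_mul_odd m n : odd n -> m %% 4 = 2 -> (m * n) %% 4 = 2.
Proof.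
move=> on m4; rewrite -modnMm m4.
have : (n %% 4 == 1) || (n %% 4 == 3) by lia.
by case/orP=> /eqP ->.
Qed.

Theorem theorem9 (N : nat) : Omega4 N -> exists A : 'M[int]_N, bimagic A.
Proof.
case=> m [n [-> [_ [m64 [m4 [n5 on]]]]]]; apply: has_square_bimagic.
(* As [n] is odd, the part [t] left after removing all factors 3 is prime to 6. *)
have [t t3 nE] : {t | coprime 3 t & n = t * 3 ^ logn 3 n} by apply: pfactor_coprime => //; lia.
set k := logn 3 n in nE.
have ot : odd t by move: on; rewrite nE oddM => /andP[].
(* The single factor 3, present when [k] is odd, stands next to [m], where a listed square with
   codes or a composite order is at hand. *)
have -> : m * n = m * 3 ^ odd k * 9 ^ k./2 * t.
  by rewrite nE -{1}(odd_double_half k) expnD -mul2n expnM; ring.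
have hb : has_square (m * 3 ^ odd k * 9 ^ k./2).
  have [h1 h3] := has_square_base m64 m4.
  by apply: has_square_mul9; case: (odd k); rewrite ?expn1 ?muln1.
have [t1|t1] := leqP t 1; first by have -> : t = 1 by [lia]; rewrite muln1.
apply: has_square_coprime6 => //.
- by rewrite -mulnA; apply: mod4_mul_odd; rewrite ?oddM ?oddX ?orbT.
- rewrite -mulnA; apply: (@leq_trans m); first by lia.
  by rewrite leq_pmulr // muln_gt0 !expn_gt0.
(* The values 2, 3 and 4 are excluded as even or divisible by 3, so [t] is at least 5. *)
- by case: t ot t3 t1 {nE hb} => [|[|[|[|[|t]]]]].
- by rewrite -[6]/(2 * 3) coprimeMr coprimen2 ot coprime_sym.
Qed.
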